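(* Let $\mathbb{F}_q$ be a finite field with $q$ elements, let $n\geq 5$ be an odd integer, and let $X^n\subset\mathbb{P}^{n+1}$ be a nonsingular hypersurface of degree $d\geq 2$ defined over $\mathbb{F}_q$. If $d\leq q$, then $$N_q(X^n)\leq\theta_n^{d,q}.$$ Moreover, equality $N_q(X^n)=\theta_n^{d,q}$ is reached only if there exists an $\mathbb{F}_q$-point $P\in X^n$ such that $X^n\cap T_PX^n$ is a cone $P*Y$ with vertex $P$ over a nonsingular hypersurface $Y\subset\mathbb{P}^{n-1}$ such that $N_q(Y)=\theta_{n-2}^{d,q}$.
   Context: For an algebraic set $W\subseteq\mathbb{P}^N$ defined by homogeneous polynomials over $\mathbb{F}_q$, $N_q(W)$ denotes the number of $\mathbb{F}_q$-points of $W$; in particular $N_q(\mathbb{P}^N)=q^N+q^{N-1}+\dots+q+1$. For an odd integer $m\geq 3$ and an integer $d\ge 2$, define $$\theta_m^{d,q}:=(d-1)q^{\frac{m+1}{2}}N_q(\mathbb{P}^{\frac{m-1}{2}})+N_q(\mathbb{P}^{\frac{m-1}{2}}).$$ A hypersurface $X^n\subset\mathbb{P}^{n+1}$ of degree $d$ (and dimension $n$) defined over $\mathbb{F}_q$ is the zero locus $V(F)$ of a nonzero homogeneous polynomial $F\in\mathbb{F}_q[x_0,\dots,x_{n+1}]$ of degree $d$. Nonsingularity is always understood over the algebraic closure $\overline{\mathbb{F}}_q$: $F$ and all its first partial derivatives have no common zero in $\mathbb{P}^{n+1}(\overline{\mathbb{F}}_q)$. For $P\in X^n(\mathbb{F}_q)$,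 $T_PX^n\cong\mathbb{P}^n$ is the (projective) tangent hyperplane to $X^n$ at $P$, and $X^n\cap T_PX^n$ is the hypersurface of $T_PX^n$ defined by the restriction of $F$. It is a cone $P*Y$ with vertex $P$ over $Y$ when, for a hyperplane $\mathbb{P}^{n-1}$ of $T_PX^n$ not containing $P$ and the hypersurface $Y\subset\mathbb{P}^{n-1}$ cut out there by $F$, the intersection is the union of the lines joining $P$ to points of $Y$. In coordinates with $P=(1:0:\dots:0)$ and $T_PX^n=V(x_{n+1})$, this means that $F|_{x_{n+1}=0}=H(x_1,\dots,x_n)$ does not involve $x_0$, and $Y=V(x_0,x_{n+1},H)$, of degree $d$. *)

(* Defs.v *)
From HB Require Import structures.
From mathcomp Require Import all_boot all_order all_algebra all_field.
From mathcomp Require Import mpoly.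

Set Implicit Arguments.
Unset Strict Implicit.
Unset Printing Implicit Defensive.

Import GRing.Theory.
Local Open Scope ring_scope.

(* Throughout, k is the number of homogeneous coordinates, so the ambient
   projective space is P^(k-1) and its points are the lines of F^k; coordinate
   vectors are row vectors. *)

Definition eval_row (R : comNzRingType) (k : nat) (p : {mpoly R[k]})
  (x : 'rV[R]_k) : R := p.@[x 0].

Definition line (F : finFieldType) (k : nat) (v : 'rV[F]_k) : {set 'rV[F]_k} :=
  [set c *: v | c : F].

(* Number of F-points of the common zero locus of the forms in S. *)
Definition Nq (F : finFieldType) (k : nat) (S : seq {mpoly F[k]}) : nat :=
  #|[set line v | v : 'rV[F]_k & (v != 0) && all (fun p => eval_row p v == 0) S]|.

Definition Nq_proj (F : finFieldType) (N : nat) : nat :=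
  Nq (Nil {mpoly F[N.+1]}).

Definition theta (F : finFieldType) (d m : nat) : nat :=
  (d.-1 * #|F| ^ (m.+1)./2 * Nq_proj F (m.-1)./2 + Nq_proj F (m.-1)./2)%N.

Definition alg_closure (F : finFieldType) : countClosedFieldType :=
  tag (countable_algebraic_closure F).

Definition to_closure (F : finFieldType) : {rmorphism F -> alg_closure F} :=
  sval (tagged (countable_algebraic_closure F)).

Definition hypersurface (F : finFieldType) (k d : nat) (p : {mpoly F[k]}) : Prop :=
  p != 0 /\ p \is d.-homog.

Definition nonsingular (F : finFieldType) (k : nat) (p : {mpoly F[k]}) : Prop :=
  forall x : 'rV[alg_closure F]_k, x != 0 ->
    ~ (eval_row (map_mpoly (to_closure F) p) x = 0 /\
       forall i : 'I_k, eval_row (map_mpoly (to_closure F) p^`M(i)) x = 0).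

(* The vectors w with \sum_i (dp/dx_i)(v) w_i = 0, as a row space. *)
Definition tangent_space (F : finFieldType) (k : nat) (p : {mpoly F[k]})
  (v : 'rV[F]_k) : 'M[F]_k := kermx (\col_i eval_row p^`M(i) v).

(* The form p(y *m A) in the indeterminates y_j: the restriction of p to the
   row space of A, in the coordinates given by the rows of A. *)
Definition restrict (F : finFieldType) (j k : nat) (A : 'M[F]_(j, k))
  (p : {mpoly F[k]}) : {mpoly F[j]} :=
  p \mPo [tuple \sum_(l < j) A l i *: 'X_l | i < k].

(* The rows of B span a hyperplane of the projective tangent space T of V(p) at
   the point P = <v>, not containing P (the dimensions force this when v is a
   nonsingular point).  So v and the rows of B are coordinates on T in which
   P = (1:0:...:0); the last equation says that p restricted to T is
   H(x_1,...,x_n), without x_0, where H = restrict B p. *)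
Definition tangent_section_is_cone (F : finFieldType) (n : nat)
  (p : {mpoly F[n.+2]}) (v : 'rV[F]_n.+2) (B : 'M[F]_(n, n.+2)) : Prop :=
  [/\ row_free B, (B <= tangent_space p v)%MS, ~~ (v <= B)%MS &
      restrict (col_mx v B) p =
        restrict (col_mx (0 : 'rV[F]_n) 1%:M) (restrict B p)].

(* Main.v *)
(* Write q = #|F| and e = d - 1, and let L be a maximal F-linear subspace of the
   zero set of p, of vector dimension l.  For v outside L the restriction of p
   to v + L is a polynomial of degree at most e, whose part of degree e,
   G_v(y) = sum_i v_i (dp/dx_i)(y), is linear in v.  So v + L contains at most
   e q^(l-1) zeros of p, and at most (e - 1) q^(l-1) if G_v = 0.

   Division of s^q - s by a polynomial f(t, s) of total degree e < q, monic in
   s, shows that either f has at most e q - max(1, e - 1) zeros in F^2, or f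
   divides s^q - s - c (t^q - t), which is a product of factors s - c t - a, and
   is a polynomial in s - c t.  Cutting v + L by parallel planes, a coset with
   G_v <> 0 thus has at least max(1, e - 1) q^(l-2) zeros less than e q^(l-1),
   unless p(v + y) depends on a single linear form in y.

   Summing over the cosets of L, a hypersurface with at least theta points has
   l = (n + 1)/2 (larger l are excluded by the projective dimension theorem), and
   few cosets are not of the latter kind.  For w in L the function
   p(v + w) - p(v), of degree less than d in v, therefore vanishes at too many
   points of the tangent space T_w to be nonzero: X = V(p) meets T_w in a cone.  As a
   consequence the cosets with G_v = 0 contain no zeros outside L, which gives
   the upper bound; in case of equality all the other cosets contain exactly
   e q^(l-1) zeros, which determines the number of points of X /\ T_w. *)

Require Import Defs.
From Stdlib Require Import Classical.
From HB Require Import structures.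
From mathcomp Require Import all_boot all_order all_algebra all_field.
From mathcomp Require Import mpoly.
From mathcomp Require Import zify ring.

Set Implicit Arguments.
Unset Strict Implicit.
Unset Printing Implicit Defensive.

Import GRing.Theory.
Local Open Scope ring_scope.

(** * Common zeros of forms over an algebraically closed field *)

Definition ideal (R : comNzRingType) (I : R -> Prop) : Prop :=
  [/\ I 0, forall a b, I a -> I b -> I (a + b) & forall a b, I b -> I (a * b)].

Lemma ideal_sum (R : comNzRingType) (I : R -> Prop) (T : Type) (r : seq T)
    (P : pred T) (f : T -> R) :
  ideal I -> (forall i, P i -> I (f i)) -> I (\sum_(i <- r | P i) f i).
Proof. by case=> I0 ID _ If; apply: (big_ind I). Qed.

Lemma idealB (R : comNzRingType) (I : R -> Prop) (a b : R) :
  ideal I -> I a -> I b -> I (a - b).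
Proof. by case=> _ ID IM Ia Ib; apply: ID => //; rewrite -mulN1r; apply: (IM). Qed.

Section Extension.
Variables (A : comNzRingType) (K : closedFieldType) (phi : {rmorphism A -> K}).
Variables (iota : K -> A) (I : {poly A} -> Prop) (P : {poly A}).
Hypothesis iotaK : forall c, phi (iota c) = c.
Hypotheses (idI : ideal I) (IP : I P) (monP : P \is monic).
Hypothesis phi0 : forall a, I a%:P -> phi a = 0.

Local Notation "g ^phi" := (map_poly phi g) (at level 2).

Lemma lift_poly (q : {poly K}) : exists q', q'^phi = q.
Proof.
exists (\poly_(i < size q) iota q`_i); apply/polyP=> i.
rewrite coef_map coef_poly; case: ltnP => [_|leq]; first exact: iotaK.
by rewrite nth_default // raddf0.
Qed.

Import Pdiv.RingMonic.

(* Multiplication by g on A[x]/(P) has a determinant that lies in the ideal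
   (g, P); it is mapped to 1 by phi. *)
Lemma ideal_no_one (g : {poly A}) : I g -> g^phi = 1 -> False.
Proof.
move=> Ig g1; have [I0 ID IM] := idI.
have szP : (size P = (size P).-1.+1)%N.
  by rewrite prednK // size_poly_gt0 monic_neq0.
set n := (size P).-1 in szP.
pose M : 'M[A]_n := \matrix_(i, j) (Pdiv.Ring.rmodp ('X^i * g) P)`_j.
have szPphi : size P^phi = n.+1.
  by rewrite size_map_poly_id0 ?szP // (monicP monP) rmorph1 oner_neq0.
have monPphi : P^phi \is monic by apply: monic_map.
have szr (i : 'I_n) : (size (Pdiv.Ring.rmodp ('X^i * g) P) <= n)%N.
  by rewrite -ltnS -szP Pdiv.Ring.ltn_rmodpN0 ?monic_neq0.
have phiM : map_mx phi M = 1%:M.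
  apply/matrixP=> i j; rewrite !mxE -coef_map.
  have := congr1 (map_poly phi) (rdivp_eq monP ('X^i * g)).
  rewrite rmorphD !rmorphM /= g1 mulr1 map_polyXn =>
    /(congr1 (fun t => Pdiv.Ring.rmodp t P^phi)).
  rewrite rmodp_addl_mul_small //; last first.
    by rewrite szPphi ltnS (leq_trans (size_poly _ _)).
  rewrite Pdiv.Ring.rmodp_small ?szPphi ?size_polyXn ?ltnS // => <-.
  by rewrite coefXn eq_sym.
have n_gt0 : (0 < n)%N.
  case: (posnP n) => // n0; have P1 : P = 1.
    by rewrite [P]size1_polyC ?szP ?n0 //; have /monicP := monP;
      rewrite lead_coefE szP n0 => ->.
  have := phi0 (a := 1); rewrite polyC1 -P1 => /(_ IP)/eqP.
  by rewrite rmorph1 oner_eq0.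
have : phi (\det M) = 0.
  apply: phi0; rewrite -det_map_mx.
  set N := map_mx _ _.
  (* Cramer's rule: [\det N] times the entry 1 of [v] is a combination of the entries of [N *m v],
     which are the remainders of ['X^j * g] modulo [P] and so lie in [I]. *)
  pose v : 'cV[{poly A}]_n := \col_j 'X^j.
  have := congr1 (mulmx^~ v) (mul_adj_mx N); rewrite -mulmxA mul_scalar_mx.
  move/matrixP/(_ (Ordinal n_gt0) 0); rewrite !mxE /= expr0 mulr1 => <-.
  apply: ideal_sum => // j _; apply: (IM).
  have -> : (N *m v) j 0 = Pdiv.Ring.rmodp ('X^j * g) P.
    rewrite mxE -[RHS]coefK poly_def
      (big_ord_widen _ (fun i => _`_i *: 'X^i) (szr j)) [RHS]big_mkcond /=.
    apply: eq_bigr => i _; rewrite !mxE mul_polyC; case: ltnP => // le.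
    by rewrite nth_default ?scale0r.
  have -> : Pdiv.Ring.rmodp ('X^j * g) P = 'X^j * g - Pdiv.Ring.rdivp ('X^j * g) P * P.
    by rewrite {2}(rdivp_eq monP ('X^j * g)) addrC addKr.
  by apply: idealB => //; apply: (IM).
by rewrite -det_map_mx phiM det1 => /eqP; rewrite oner_eq0.
Qed.

(** A zero [phi] of the elimination ideal lifts to a zero of [I]. The common root is found by
    descent on the degree, starting from [P]: if some [g1^phi] does not vanish at a root of [g^phi],
    its remainder by [g^phi] is nonzero of smaller degree, and [ideal_no_one] excludes nonzero
    constants. *)
Lemma extension : exists b, forall g, I g -> g^phi.[b] = 0.
Proof.
have [I0 ID IM] := idI.
suff H s : forall g, I g -> g^phi != 0 -> (size g^phi <= s)%N ->
    exists b, forall g, I g -> g^phi.[b] = 0.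
  by apply: (H _ P) => //; rewrite monic_neq0 ?monic_map.
elim: s => [|s IHs] g Ig g0; first by rewrite leqn0 size_poly_eq0 (negPf g0).
move=> les; have [sz1|sz1] := eqVneq (size g^phi) 1.
  case: (@ideal_no_one ((iota ((g^phi)`_0)^-1)%:P * g)); first exact: IM.
  have [c c0 gc] := size_poly1P _ (introT eqP sz1).
  by rewrite rmorphM /= map_polyC /= iotaK gc coefC /= -polyCM mulVf.
have [b /eqP gb] := closed_rootP _ sz1.
case: (classic (forall g, I g -> g^phi.[b] = 0)) => [|H]; first by exists b.
have [g1 Ig1 g1b] : exists2 g1, I g1 & g1^phi.[b] != 0.
  apply: NNPP => H1; apply: H => g2 Ig2; apply/eqP; apply: contraT => g2b.
    by case: H1; exists g2.
have [q qE] := lift_poly (g1^phi %/ g^phi).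
have E : (g1 - q * g)^phi = g1^phi %% g^phi.
  rewrite rmorphB rmorphM /= qE {1}(divp_eq g1^phi g^phi) addrC addKr //.
apply: (IHs (g1 - q * g)); first by apply: idealB => //; apply: (IM).
  apply/eqP=> /(congr1 (horner^~ b)); rewrite rmorphB rmorphM /= !hornerE gb.
  by rewrite mulr0 subr0; apply/eqP.
rewrite E -ltnS (leq_trans _ les) // ltn_modp //.
Qed.

End Extension.

Lemma pihomogM (R : comNzRingType) (n d e : nat) (u g : {mpoly R[n]}) :
  g \is e.-homog ->
  pihomog mdeg (d + e) (u * g) = pihomog mdeg d u * g.
Proof.
move=> hg; rewrite [u in LHS]mpolyE mulr_suml !linear_sum /=.
rewrite [u in RHS]mpolyE linear_sum /= mulr_suml; apply: eq_bigr => m _.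
rewrite -scalerAl !linearZ /= -scalerAl; congr (_ *: _).
rewrite pihomogX; have [<-|ne] := eqVneq (mdeg m) d.
  by apply: pihomog_dE; apply: dhomogM => //; rewrite dhomogX.
rewrite mul0r (@pihomog_ne0 _ _ _ (mdeg m + e)) ?eqn_add2r //.
by apply: dhomogM => //; rewrite dhomogX.
Qed.

Lemma pihomogM_lt (R : comNzRingType) (n d e : nat) (u g : {mpoly R[n]}) :
  g \is e.-homog -> (d < e)%N -> pihomog mdeg d (u * g) = 0.
Proof.
move=> hg lt; rewrite [u]mpolyE mulr_suml linear_sum /= big1 // => m _.
rewrite -scalerAl linearZ /= (@pihomog_ne0 _ _ _ (mdeg m + e)) ?scaler0 //.
  by rewrite gtn_eqF // ltn_addl.
by apply: dhomogM => //; rewrite dhomogX.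
Qed.

Definition mnmtrunc (n : nat) (m : 'X_{1..n.+1}) : 'X_{1..n} :=
  [multinom m (widen_ord (leqnSn n) i) | i < n].

Lemma mdeg_trunc n (m : 'X_{1..n.+1}) : mdeg m = (mdeg (mnmtrunc m) + m ord_max)%N.
Proof.
rewrite !mdegE big_ord_recr /=; congr (_ + _)%N.
by apply: eq_bigr => i _; rewrite mnmE.
Qed.

Lemma mnmtruncK (R : nzRingType) n (m : 'X_{1..n.+1}) :
  'X_[m] = mwiden 'X_[mnmtrunc m] * 'X_ord_max ^+ (m ord_max) :> {mpoly R[n.+1]}.
Proof.
rewrite mwidenX mpolyXn -mpolyXD; congr 'X_[_].
apply/mnmP=> i; rewrite mnmDE mulmnE mnm1E.
have [<-|ne] := eqVneq ord_max i.
  by rewrite mnmwiden_ordmax mul1n.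
rewrite mul0n addn0.
have lt : (i < n)%N.
  by rewrite ltn_neqAle -ltnS ltn_ord andbT; apply: contra ne => /eqP e;
    apply/eqP/val_inj.
have -> : i = widen_ord (leqnSn n) (Ordinal lt) by apply: val_inj.
by rewrite mnmwiden_widen mnmE.
Qed.

(** The coefficient of the i-th power of the last variable. *)
Definition last_coef (R : nzRingType) n (p : {mpoly R[n.+1]}) (i : nat) : {mpoly R[n]} :=
  \sum_(m <- msupp p | m ord_max == i) p@_m *: 'X_[mnmtrunc m].

Lemma last_coef_homog (R : nzRingType) n d (p : {mpoly R[n.+1]}) i :
  p \is d.-homog -> last_coef p i \is (d - i).-homog.
Proof.
move/dhomogP=> hp; rewrite /last_coef big_seq_cond;
  apply: rpred_sum => m /andP[mp /eqP <-].
by apply: rpredZ; rewrite dhomogX /= -(hp _ mp) /= mdeg_trunc addnK.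
Qed.

Lemma last_coefE (R : nzRingType) n d (p : {mpoly R[n.+1]}) :
  p \is d.-homog -> p = \sum_(i < d.+1) mwiden (last_coef p i) * 'X_ord_max ^+ i.
Proof.
move/dhomogP=> hp; rewrite {1}[p]mpolyE.
under [RHS]eq_bigr => i _ do rewrite raddf_sum mulr_suml.
rewrite (exchange_big_dep xpredT) //= big_seq [RHS]big_seq; apply: eq_bigr => m mp.
have lt : (m ord_max < d.+1)%N by rewrite ltnS -(hp _ mp) /= mdeg_trunc leq_addl.
rewrite (eq_bigl (pred1 (Ordinal lt))) ?big_pred1_eq; last by move=> i;
  rewrite /= eq_sym.
by rewrite mwidenZ -scalerAl -mnmtruncK.
Qed.

Lemma meval_mwiden (R : comNzRingType) n (p : {mpoly R[n]}) (v : 'I_n.+1 -> R) :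
  (mwiden p).@[v] = p.@[v \o widen_ord (leqnSn n)].
Proof.
rewrite [p]mpolyE (big_morph _ (@mwidenD n R) (@mwiden0 n R)) !raddf_sum /=;
  apply: eq_bigr => m _.
rewrite mwidenZ !mevalZ mwidenX !mevalX big_ord_recr /= mnmwiden_ordmax expr0 mulr1.
by congr (_ * _); apply: eq_bigr => i _; rewrite mnmwiden_widen.
Qed.

Lemma homog_meval0 (R : comNzRingType) n d (p : {mpoly R[n]}) v :
  p \is d.-homog -> (0 < d)%N -> (forall i, v i = 0) -> p.@[v] = 0.
Proof.
move=> /dhomogP hp d0 v0; rewrite mevalE big_seq big1 // => m mp.
have [i mi] : exists i, m i != 0%N.
  case: (pickP (fun i => m i != 0%N)) => [i mi|H]; first by exists i.
  move: d0; rewrite -(hp _ mp) /= mdegE big1 // => i _.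
  by have /negbFE/eqP := H i.
by rewrite (bigD1 i) //= v0 expr0n (negPf mi) mul0r mulr0.
Qed.

Lemma homog0_const (R : nzRingType) n (p : {mpoly R[n]}) :
  p \is 0.-homog -> p = (p@_0)%:MP.
Proof.
move/dhomogP=> hp; apply/mpolyP=> m; rewrite mcoeffC.
have [->|ne] := eqVneq m 0%MM; first by rewrite mulr1.
rewrite mulr0; apply/eqP; rewrite mcoeff_eq0; apply: contra ne => /hp /eqP.
by rewrite /= mdeg_eq0 => /eqP ->.
Qed.

(** Membership in the radical of [I]. *)
Definition nil_mod (R : comNzRingType) (I : R -> Prop) (f : R) := exists M, I (f ^+ M).

Lemma nil_modM (R : comNzRingType) (I : R -> Prop) f g :
  ideal I -> nil_mod I g -> nil_mod I (f * g).
Proof. by case=> _ _ IM [M H]; exists M; rewrite exprMn; apply: IM. Qed.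

Lemma nil_modD (R : comNzRingType) (I : R -> Prop) f g :
  ideal I -> nil_mod I f -> nil_mod I g -> nil_mod I (f + g).
Proof.
move=> idI [M HM] [N HN]; have [I0 ID IM] := idI.
exists (M + N)%N; rewrite exprDn; apply: ideal_sum => // i _.
rewrite -mulr_natl; apply: (IM).
case: (leqP N i) => [le|lt].
  by rewrite -(subnK le) exprD mulrA; apply: (IM).
have le : (M <= M + N - i)%N by rewrite -addnBA ?leq_addr // ltnW.
by rewrite -(subnK le) exprD mulrC mulrA; apply: (IM).
Qed.

Lemma nil_mod_sum (R : comNzRingType) (I : R -> Prop) (T : Type) (r : seq T)
    (P : pred T) (f : T -> R) :
  ideal I -> (forall i, P i -> nil_mod I (f i)) -> nil_mod I (\sum_(i <- r | P i) f i).
Proof.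
move=> idI H; apply: (big_ind (nil_mod I)) => //.
  by exists 1%N; rewrite expr1; case: idI.
by move=> a b; apply: nil_modD.
Qed.

(** Homogeneous Nullstellensatz, by elimination of the last variable. If the last coordinate point
    is not a zero of [I], then [I] contains a form monic in the last variable. Zeros of the
    elimination ideal [J] then extend; if [J] has none, this form puts the last variable in the
    radical too. *)
Lemma homog_nullstellensatz (K : closedFieldType) n (I : {mpoly K[n]} -> Prop) :
  ideal I -> (forall d f, I f -> I (pihomog mdeg d f)) ->
  (exists x : 'I_n -> K, (exists i, x i != 0) /\ forall f, I f -> f.@[x] = 0) \/
  (forall f, f@_0 = 0 -> nil_mod I f).
Proof.
elim: n I => [|n IHn] I idI homI.
  right=> f f0; exists 1%N; rewrite expr1; case: idI => I0 _ _.
  suff -> : f = 0 by [].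
  by apply/mpolyP=> m; rewrite mcoeff0 -f0; congr (_@_ _); apply/mnmP; case.
have [I0 ID IM] := idI.
pose psi (P : {poly {mpoly K[n]}}) : {mpoly K[n.+1]} :=
  (map_poly (@mwiden n K) P).['X_ord_max].
have psiD P Q : psi (P + Q) = psi P + psi Q by rewrite /psi rmorphD hornerD.
have psiM P Q : psi (P * Q) = psi P * psi Q by rewrite /psi rmorphM hornerM.
have psiC c : psi c%:P = mwiden c by rewrite /psi map_polyC hornerC.
have psi0 : psi 0 = 0 by rewrite /psi rmorph0 horner0.
have psiX : psi 'X = 'X_ord_max by rewrite /psi map_polyX hornerX.
have psiXn i : psi 'X^i = 'X_ord_max ^+ i by rewrite /psi rmorphXn /= map_polyX
  hornerXn.
have psi_sum (m : nat) (f : 'I_m -> {poly {mpoly K[n]}}) :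
    psi (\sum_(i < m) f i) = \sum_(i < m) psi (f i).
  exact: (big_morph psi psiD psi0).
have psi_surj f : exists P, psi P = f.
  exists (\sum_(m <- msupp f) (f@_m *: 'X_[mnmtrunc m])%:P * 'X^(m ord_max)).
  rewrite (big_morph psi psiD psi0) [RHS]mpolyE; apply: eq_bigr => m _.
  by rewrite psiM psiC psiXn mwidenZ -scalerAl -mnmtruncK.
pose J (f : {mpoly K[n]}) := I (mwiden f).
have idJ : ideal J.
  rewrite /J; split; rewrite ?mwiden0 // => a b; rewrite ?mwidenD ?mwidenM;
    [exact: ID|exact: IM].
have pihomog_mwiden d (f : {mpoly K[n]}) :
    pihomog mdeg d (mwiden f) = mwiden (pihomog mdeg d f).
  have W := big_morph _ (@mwidenD n K) (@mwiden0 n K).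
  rewrite [f]mpolyE W !linear_sum /= W; apply: eq_bigr => m _.
  rewrite mwidenZ !linearZ /= mwidenZ mwidenX !pihomogX.
  rewrite /= mdeg_trunc mnmwiden_ordmax addn0.
  have -> : mnmtrunc (mnmwiden m) = m by apply/mnmP=> i; rewrite mnmE mnmwiden_widen.
  by case: eqP; rewrite ?mwidenX ?mwiden0.
have homJ d f : J f -> J (pihomog mdeg d f) by rewrite /J -pihomog_mwiden; apply: homI.
pose e : 'I_n.+1 -> K := fun i => (i == ord_max)%:R.
case: (classic (forall f, I f -> f.@[e] = 0)) => [H|H].
  by left; exists e; split=> //; exists ord_max; rewrite /e eqxx oner_neq0.
have [f If fe] : exists2 f, I f & f.@[e] != 0.
  apply: NNPP => H1; apply: H => f If; apply/eqP; apply: contraT => fe.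
  by case: H1; exists f.
(* Since [I] is homogeneous, it contains a homogeneous part of [f] that is nonzero at [e]; scaled to
   the value 1 there, it becomes monic in the last variable. *)
have [d gde] : exists d, (pihomog mdeg d f).@[e] != 0.
  apply: NNPP => H1; case/negP: fe;
    rewrite (pihomog_partitionE (leqnn (mmeasure mdeg f))).
  rewrite raddf_sum /= big1 // => d _; apply/eqP; apply: contraT => fe.
  by case: H1; exists d.
pose c := (pihomog mdeg d f).@[e].
pose g := c^-1 *: pihomog mdeg d f.
have Ig : I g by rewrite /g -mul_mpolyC; apply: (IM); apply: homI.
have hg : g \is d.-homog by apply: rpredZ; apply: pihomogP.
have ge : g.@[e] = 1 by rewrite /g mevalZ mulVf.
pose R := \sum_(i < d) (last_coef g i)%:P * 'X^i.
have ew i : (e \o widen_ord (leqnSn n)) i = 0.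
  by rewrite /e /= -val_eqE /= ltn_eqF.
have gd : last_coef g d = 1.
  have h0 := last_coef_homog d hg; rewrite subnn in h0.
  rewrite (homog0_const h0) -[RHS]mpolyC1; congr _%:MP.
  rewrite -ge [in RHS](last_coefE hg) big_ord_recr /= mevalD
    (big_morph _ (mevalD e) (meval0 e)) [X in _ = X + _]big1 => [|i _].
    rewrite add0r mevalM rmorphXn /= mevalXU /e eqxx expr1n mulr1 meval_mwiden.
    by rewrite [in RHS](homog0_const h0) mevalC.
  rewrite mevalM meval_mwiden (homog_meval0 (last_coef_homog i hg)) ?mul0r //.
  by rewrite subn_gt0.
have gE : g = psi ('X^d + R).
  rewrite psiD psiXn /R psi_sum {1}(last_coefE hg) big_ord_recr /= gd mwiden1 mul1r
    addrC.
  by congr (_ + _); apply: eq_bigr => i _; rewrite psiM psiC psiXn.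
have szR : (size R <= d)%N.
  apply: (leq_trans (size_sum _ _ _)); apply/bigmax_leqP => i _.
  by rewrite mul_polyC (leq_trans (size_scale_leq _ _)) // size_polyXn.
have monP : 'X^d + R \is monic.
  by rewrite monicE lead_coefDl ?lead_coefXn // size_polyXn ltnS.
case: (IHn J idJ homJ) => [[x [[i xi] x0]]|nilJ].
  left.
  have idI' : ideal (fun P => I (psi P)).
    split; rewrite ?psi0 // => a b; rewrite ?psiD ?psiM; [exact: ID|exact: IM].
  have [|||b Hb] := @extension _ K (meval x) (@mpolyC n K) _ ('X^d + R) _ idI' _ monP.
  - by move=> a; apply: mevalC.
  - by rewrite -gE.
  - by move=> a; rewrite psiC; apply: x0.
  pose y (j : 'I_n.+1) := if unlift ord_max j is Some j' then x j' else b.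
  have yw j : y (widen_ord (leqnSn n) j) = x j.
    rewrite /y; have -> : widen_ord (leqnSn n) j = lift ord_max j.
      by apply: val_inj; rewrite /= /bump leqNgt ltn_ord.
    by rewrite liftK.
  have yb : y ord_max = b by rewrite /y unlift_none.
  exists y; split; first by exists (widen_ord (leqnSn n) i); rewrite yw.
  move=> h; have [P <-] := psi_surj h => IP; rewrite -[RHS](Hb _ IP).
  rewrite /psi -horner_map /= -map_poly_comp /= mevalXU yb.
  congr (_.[_]); apply: eq_map_poly => q /=; rewrite meval_mwiden.
  by apply: meval_eq => j /=; rewrite yw.
right.
have nilw (h : {mpoly K[n]}) : h@_0 = 0 -> nil_mod I (mwiden h).
  by move/nilJ=> [M HM]; exists M; rewrite -rmorphXn.
(* Modulo [I], the d-th power of the last variable is minus [psi R], whose coefficients are forms of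
   positive degree and hence nilpotent. *)
have nilX : nil_mod I ('X_ord_max : {mpoly K[n.+1]}).
  suff [M HM] : nil_mod I ('X_ord_max ^+ d : {mpoly K[n.+1]}) by exists (d * M)%N;
    rewrite exprM.
  have -> : 'X_ord_max ^+ d = g + (-1) * psi R :> {mpoly K[n.+1]}.
    by rewrite gE psiD psiXn mulN1r addrK.
  apply: nil_modD => //; first by exists 1%N; rewrite expr1.
  apply: nil_modM => //; rewrite psi_sum; apply: nil_mod_sum => // i _.
  rewrite psiM psiC mulrC; apply: nil_modM => //; apply: nilw.
  apply/eqP; move/dhomogP: (last_coef_homog i hg) => hh; rewrite mcoeff_eq0;
    apply/negP=> /hh.
  by rewrite /= mdeg0 => /esym/eqP; rewrite subn_eq0 leqNgt ltn_ord.
move=> h h0; rewrite [h]mpolyE big_seq; apply: nil_mod_sum => // m mh.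
rewrite -mul_mpolyC; apply: nil_modM => //; rewrite mnmtruncK.
case: (posnP (m ord_max)) => [m0|mpos]; last first.
  by rewrite -(prednK mpos) exprSr mulrA; apply: nil_modM.
rewrite mulrC; apply: nil_modM => //; apply: nilw; rewrite mcoeffX.
case: eqP => // E; move: mh; rewrite mcoeff_msupp.
have -> : m = 0%MM; last by rewrite h0 eqxx.
by apply/eqP; rewrite -mdeg_eq0 mdeg_trunc E mdeg0 m0.
Qed.

(* If all powers X_i^M lie in (G_1, ..., G_c), then the products x^a G^b with
   a_i < M span all polynomials; there are too few of them when c < l. *)
Lemma forms_nil_bound (K : fieldType) (l c e M : nat) (G : 'I_c -> {mpoly K[l]})
    (u : 'I_l -> 'I_c -> {mpoly K[l]}) :
  (0 < e)%N -> (e <= M)%N -> 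
  (forall i j, u i j \is (M - e).-homog) ->
  (forall i, 'X_i ^+ M = \sum_j u i j * G j) -> (l <= c)%N.
Proof.
move=> e_gt0 leM hu uG; rewrite leqNgt; apply/negP=> lt_cl.
have M_gt0 : (0 < M)%N by apply: leq_trans leM.
(* [B] exceeds the degree of every monomial with exponents below [Q], hence all exponents of [G]
   that arise. [Q] is large enough for M^l B^c < Q^(c+1) <= Q^l. *)
pose Q := (M ^ l * l.+1 ^ c).+1; pose B := (l * Q).+1.
pose T := ({ffun 'I_l -> 'I_M} * {ffun 'I_c -> 'I_B})%type.
pose mon N (a : {ffun 'I_l -> 'I_N}) : 'X_{1..l} := [multinom (a i : nat) | i < l].
pose t (x : T) : {mpoly K[l]} := 'X_[mon _ x.1] * \prod_j G j ^+ x.2 j.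
pose Sp (f : {mpoly K[l]}) := exists k : T -> K, f = \sum_x k x *: t x.
have Sp0 : Sp 0.
  by exists (fun _ => 0); rewrite big1 // => x _; rewrite scale0r.
have SpD f g : Sp f -> Sp g -> Sp (f + g).
  case=> k1 -> [k2 ->]; exists (fun x => k1 x + k2 x); rewrite -big_split /=.
  by apply: eq_bigr => x _; rewrite scalerDl.
have SpZ a f : Sp f -> Sp (a *: f).
  case=> k ->; exists (fun x => a * k x); rewrite scaler_sumr.
  by apply: eq_bigr => x _; rewrite scalerA.
have Sp_sum (J : Type) (r : seq J) (P : pred J) (f : J -> {mpoly K[l]}) :
    (forall i, P i -> Sp (f i)) -> Sp (\sum_(i <- r | P i) f i).
  by move=> H; apply: (big_ind Sp).
have span D : forall (m : 'X_{1..l}) (b : 'I_c -> nat), (mdeg m <= D)%N ->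
    (forall j, b j + D < B)%N -> Sp ('X_[m] * \prod_j G j ^+ b j).
  elim/ltn_ind: D => D IH m b mD bD.
  case: (pickP (fun i => M <= m i)%N) => [i Mi|lt].
    have UM : (U_(i) *+ M <= m)%MM.
      by apply/mnm_lepP => j; rewrite mulmnE mnm1E; case: eqP => [<-|]; rewrite ?mul1n.
    (* Substituting for ['X_i ^+ M] lowers the degree of the monomial by [e] and raises one exponent
       of [G] by 1, which preserves the bound [b j + D < B]. *)
    rewrite -(submK UM) mpolyXD -mpolyXn uG mulr_sumr mulr_suml.
    apply: (Sp_sum) => j _; set m' := (m - _)%MM.
    have -> : 'X_[m'] * (u i j * G j) * (\prod_k G k ^+ b k) =
        ('X_[m'] * u i j) * \prod_k G k ^+ (b k + (k == j))%N.
      rewrite -!mulrA; congr (_ * (_ * _)).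
      rewrite (bigD1 j) //= [in RHS](bigD1 j) //= eqxx addn1 exprS -mulrA.
      by do 2!congr (_ * _); apply: eq_bigr => k /negPf ->; rewrite addn0.
    have degm : mdeg m = (mdeg m' + M)%N.
      by rewrite -{1}(submK UM) mdegD mdegMn mdeg1 mul1n.
    rewrite [u i j]mpolyE mulr_sumr mulr_suml big_seq; apply: (Sp_sum) => m2 m2u.
    rewrite -scalerAr -scalerAl -mpolyXD; apply: (SpZ).
    have dm2 : mdeg m2 = (M - e)%N by move/dhomogP: (hu i j); apply.
    have ltD : (D.-1 < D)%N.
      by rewrite prednK // (leq_trans _ mD) // degm ltn_addl.
    apply: (IH D.-1) => //.
      rewrite mdegD dm2 -ltnS (ltn_predK ltD) (leq_trans _ mD) // degm ltn_add2l.
      by rewrite ltn_subrL e_gt0.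
    move=> k; apply: leq_ltn_trans (bD k); rewrite -addnA leq_add2l.
    by rewrite -{2}(ltn_predK ltD) -add1n leq_add2r; case: eqP.
  have bB j : (b j < B)%N by apply: leq_ltn_trans (bD j); rewrite leq_addr.
  have mM i : (m i < M)%N by rewrite ltnNge lt.
  exists (fun x => (x == ([ffun i => Ordinal (mM i)], [ffun j => Ordinal (bB j)]))%:R).
  rewrite (bigD1 ([ffun i => Ordinal (mM i)], [ffun j => Ordinal (bB j)])) //= eqxx
    scale1r.
  rewrite [X in _ = _ + X]big1 => [|x /negPf ->]; last by rewrite scale0r.
  rewrite addr0 /t /=; congr (_ * _).
    by congr 'X_[_]; apply/mnmP=> i; rewrite mnmE ffunE.
  by apply: eq_bigr => j _; rewrite ffunE.
pose S := {ffun 'I_l -> 'I_Q}.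
have spS (s : S) : exists k : {ffun T -> K}, 'X_[mon _ s] = \sum_x k x *: t x.
  have [||k kE] := span (l * Q)%N (mon _ s) (fun _ => 0%N).
  - rewrite mdegE; apply: (@leq_trans (\sum_(i < l) Q)%N); last first.
      by rewrite sum_nat_const card_ord.
    by apply: leq_sum => i _; rewrite mnmE ltnW.
  - by move=> j; rewrite add0n.
  exists [ffun x => k x]; rewrite -[LHS]mulr1.
  move: kE; rewrite big1 => [->|j _]; last by rewrite expr0.
  by apply: eq_bigr => x _; rewrite ffunE.
have [k kE] := fin_all_exists spS.
(* [A] writes the monomials indexed by [S] in terms of the spanning products, and [C] extracts the
   coefficients of these monomials; [A *m C = 1] bounds #S by #T. *)
pose A : 'M[K]_(#|{: S}|, #|{: T}|) :=
  \matrix_(i, j) k (enum_val i) (enum_val j).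
pose C : 'M[K]_(#|{: T}|, #|{: S}|) :=
  \matrix_(i, j) (t (enum_val i))@_(mon _ (enum_val j)).
have AC : A *m C = 1%:M.
  apply/matrixP=> i j; rewrite !mxE.
  have := congr1 (mcoeff (mon _ (enum_val j))) (kE (enum_val i)).
  rewrite mcoeffX raddf_sum /= (reindex_onto (@enum_val _ {: T}) enum_rank) /=;
    last first.
    by move=> x _; rewrite enum_rankK.
  rewrite (eq_bigl xpredT) => [E|x]; last by rewrite enum_valK eqxx.
  have -> : (i == j) = (mon _ (enum_val i) == mon _ (enum_val j)).
    rewrite -(inj_eq (@enum_val_inj _ _)); apply/eqP/eqP => [->//|].
    move=> /mnmP H; apply/ffunP=> x; apply: val_inj.
    by have := H x; rewrite !mnmE.
  by rewrite E; apply: eq_bigr => x _; rewrite !mxE mcoeffZ.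
have : (#|{: S}| <= #|{: T}|)%N.
  rewrite -[X in (X <= _)%N](mxrank1 K) -AC.
  exact: leq_trans (mxrankM_maxl _ _) (rank_leq_col _).
rewrite card_prod !card_ffun !card_ord leqNgt => /negP; apply.
have lB : (B <= l.+1 * Q)%N by rewrite mulSn /B -add1n leq_add2r.
apply: (@leq_ltn_trans (M ^ l * (l.+1 * Q) ^ c)%N).
  by rewrite leq_mul2l; apply/orP; right; case: (c) => // c'; rewrite leq_exp2r.
rewrite expnMn mulnA; apply: (@leq_trans (Q * Q ^ c)%N); last first.
  by rewrite -expnS leq_pexp2l.
by rewrite ltn_mul2r expn_gt0 /= /Q ltnS leqnn.
Qed.

(** Without a common zero, the Nullstellensatz puts powers of all variables in the ideal of the
    [G j]; homogeneous parts provide coefficients of the right degree, against [forms_nil_bound]. *)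
Lemma forms_common_zero (K : closedFieldType) (l c e : nat)
    (G : 'I_c -> {mpoly K[l]}) :
  (c < l)%N -> (0 < e)%N -> (forall j, G j \is e.-homog) ->
  exists x : 'I_l -> K, (exists i, x i != 0) /\ forall j, (G j).@[x] = 0.
Proof.
move=> lt_cl e_gt0 hG.
pose I f := exists u : 'I_c -> {mpoly K[l]}, f = \sum_j u j * G j.
have idI : ideal I.
  split.
  - by exists (fun _ => 0); rewrite big1 // => j _; rewrite mul0r.
  - move=> a b [u ->] [v ->]; exists (fun j => u j + v j); rewrite -big_split /=.
    by apply: eq_bigr => j _; rewrite mulrDl.
  - move=> a b [u ->]; exists (fun j => a * u j); rewrite mulr_sumr.
    by apply: eq_bigr => j _; rewrite mulrA.
have homI_lt d f : (d < e)%N -> I f -> pihomog mdeg d f = 0.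
  by move=> lt [u ->]; rewrite linear_sum big1 // => j _;
    rewrite /= (pihomogM_lt _ (hG j)).
have homI_ge d f : (e <= d)%N -> I f -> exists2 u : 'I_c -> {mpoly K[l]},
    forall j, u j \is (d - e).-homog & pihomog mdeg d f = \sum_j u j * G j.
  move=> le [u ->]; exists (fun j => pihomog mdeg (d - e) (u j)).
    by move=> j; apply: pihomogP.
  rewrite linear_sum; apply: eq_bigr => j _ /=.
  by rewrite -(pihomogM _ _ (hG j)) subnK.
have homI d f : I f -> I (pihomog mdeg d f).
  move=> If; case: (leqP e d) => [le|lt]; last by rewrite (homI_lt _ _ lt If);
    case: idI.
  by have [u _ ->] := homI_ge _ _ le If; exists u.
case: (homog_nullstellensatz idI homI) => [[x [x0 xI]]|nilI].
  exists x; split=> // j; apply: xI; exists (fun k => (k == j)%:R).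
  rewrite (bigD1 j) //= eqxx mul1r big1 ?addr0 // => k /negPf ->.
  by rewrite mul0r.
have nilX i : exists M, I ('X_i ^+ M).
  by apply: nilI; rewrite mcoeffX; case: eqP => // /(congr1 (@mdeg l));
    rewrite mdeg1 mdeg0.
have [M HM] := fin_all_exists nilX.
(* One exponent that works for all variables and is at least [e]. *)
pose N := ((\sum_i M i) + e)%N.
have leN : (e <= N)%N by rewrite leq_addl.
have HN i : exists u : {ffun 'I_c -> {mpoly K[l]}},
    (forall j, u j \is (N - e).-homog) /\ 'X_i ^+ N = \sum_j u j * G j.
  have IN : I ('X_i ^+ N).
    have le : (M i <= N)%N by rewrite (leq_trans _ (leq_addr _ _)) // (bigD1 i) //=
      leq_addr.
    by rewrite -(subnK le) exprD; case: idI => _ _; apply; apply: HM.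
  have [u hu uE] := homI_ge _ _ leN IN.
  exists (finfun u); split=> [j|]; first by rewrite ffunE.
  rewrite -[LHS](@pihomog_dE _ _ mdeg N); last first.
    by rewrite mpolyXn dhomogX /= mdegMn mdeg1 mul1n.
  by rewrite uE; apply: eq_bigr => j _; rewrite ffunE.
have [u uE] := fin_all_exists HN.
have := @forms_nil_bound K l c e N G (fun i j => u i j) e_gt0 leN.
rewrite leqNgt lt_cl => H; case: notF; apply: H => [i j|i]; case: (uE i) => //.
Qed.

(** * Plane curves with many points over a finite field *)

Section Planar.
Variable F : finFieldType.
Local Notation q := #|F|.

Lemma card_roots_lt (p : {poly F}) : p != 0 -> (#|[set s | root p s]| < size p)%N.
Proof.
move=> p0; rewrite cardE; apply: max_poly_roots => //; last exact: enum_uniq.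
by apply/allP=> s; rewrite mem_enum inE.
Qed.

Lemma poly_vanish (p : {poly F}) : (size p <= q)%N -> (forall s, p.[s] = 0) -> p = 0.
Proof.
move=> sz p0; apply/eqP/negPn/negP=> /card_roots_lt.
rewrite ltnNge => /negP; apply; apply: (leq_trans sz).
by rewrite -cardsT; apply: subset_leq_card; apply/subsetP=> s _; rewrite inE rootE p0.
Qed.

Lemma poly_eq_fun (p1 p2 : {poly F}) : (size p1 <= q)%N -> (size p2 <= q)%N ->
  (forall s, p1.[s] = p2.[s]) -> p1 = p2.
Proof.
move=> sz1 sz2 H; apply/eqP; rewrite -subr_eq0; apply/eqP; apply: poly_vanish => [|s].
  by rewrite (leq_trans (size_polyD _ _)) // geq_max size_polyN sz1.
by rewrite hornerD hornerN H subrr.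
Qed.

Lemma poly_vanish_card (p : {poly F}) : (size p <= q.+1)%N -> (forall s, p.[s] = 0) ->
  p = p`_q *: ('X^q - 'X).
Proof.
move=> sz p0; apply/eqP; rewrite -subr_eq0; apply/eqP; apply: poly_vanish => [|s].
  apply/leq_sizeP => j; rewrite leq_eqVlt => /orP[/eqP <-|lt].
    rewrite coefB coefZ coefB coefXn coefX eqxx gtn_eqF ?finNzRing_gt1 //.
    by rewrite subr0 mulr1 subrr.
  rewrite coefB coefZ coefB coefXn coefX nth_default ?(leq_trans sz) //.
  have lt1 : (1 < j)%N by apply: ltn_trans lt; apply: finNzRing_gt1.
  by rewrite (gtn_eqF lt) (gtn_eqF lt1) subrr mulr0 subrr.
by rewrite hornerD hornerN hornerZ hornerD hornerN hornerXn hornerX p0 expf_card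
  subrr mulr0 subrr.
Qed.

(* Total degree at most D. *)
Definition tdeg_le (D : nat) (g : {poly {poly F}}) :=
  forall i, (size (g`_i)%R <= D.+1 - i)%N.

(** A division step subtracts a s^(m-e) f with deg a <= D - m; the coefficient of s^j in f has
    degree at most e - j, so the total degree stays within [D]. *)
Lemma tdeg_division (f g : {poly {poly F}}) (e D : nat) :
  f \is monic -> size f = e.+1 -> tdeg_le e f -> tdeg_le D g ->
  exists h r, [/\ g = h * f + r, (size r <= e)%N & tdeg_le D r].
Proof.
move=> monf szf tf; have [n] := ubnP (size g); elim: n g => // n IH g szg tg.
case: (leqP (size g) e) => [le|lt].
  by exists 0, g; rewrite mul0r add0r.
pose m := (size g).-1; pose a := g`_m.
have sg : size g = m.+1 by rewrite prednK // (leq_ltn_trans _ lt).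
have lem : (e <= m)%N by rewrite -ltnS -sg.
have a0 : (0 < size a)%N.
  by rewrite size_poly_gt0 /a -[m]/((m.+1).-1) -sg -lead_coefE lead_coef_eq0
    -size_poly_gt0 sg.
pose k := (a%:P * 'X^(m - e)) * f.
have kE i : k`_i = if (i < m - e)%N then 0 else a * f`_(i - (m - e)).
  by rewrite /k -mulrA coefCM coefXnM; case: ifP; rewrite ?mulr0.
have [||h [r [gE szr tr]]] := IH (g - k).
- rewrite -ltnS (leq_trans _ szg) // sg ltnS.
  apply/leq_sizeP => j lej; rewrite coefB kE ifN ?subn_gt0; last by rewrite -leqNgt;
    lia.
  move: lej; rewrite leq_eqVlt => /orP[/eqP <-|ltj].
    have -> : (m - (m - e) = e)%N by lia.
    have -> : f`_e = 1 by rewrite -(monicP monf) lead_coefE szf.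
    by rewrite mulr1 subrr.
  rewrite nth_default ?sg // nth_default ?mulr0 ?subr0 // szf; lia.
- move=> i; rewrite coefB; apply: (leq_trans (size_polyD _ _)); rewrite size_polyN.
  rewrite geq_max tg /= kE; case: ltnP => le; first by rewrite size_poly0.
  case: (leqP i m) => lei; last first.
    by have -> : f`_(i - (m - e)) = 0;
      rewrite ?mulr0 ?size_poly0 // nth_default // szf; lia.
  apply: (leq_trans (size_polyMleq _ _)).
  by have := tg m; have := tf (i - (m - e))%N; rewrite -/a; lia.
exists (h + a%:P * 'X^(m - e)), r; split=> //.
by rewrite mulrDl -/k addrAC -gE subrK.
Qed.

(** This makes raising to the power q additive on polynomials over [F]. *)
Lemma pchar_nat_card : [pchar F].-nat q.
Proof.
have [p pr pF] := finPcharP F.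
rewrite (eq_pnat _ (pcharf_eq pF)) -cardsT.
exact: (pprimeChar_pgroup pF).
Qed.

Lemma root_tdeg (r : {poly {poly F}}) (i : nat) tau :
  (forall j, (i < j)%N -> (r`_j).[tau] = 0) -> (r`_i).[tau] != 0 ->
  (#|[set s | root (map_poly (horner_eval tau) r) s]| <= i)%N.
Proof.
move=> rj ri; rewrite -ltnS; set p := map_poly _ _.
have pi : p`_i != 0 by rewrite coef_map.
have p0 : p != 0 by apply: contraNneq pi => ->; rewrite coef0.
apply: (leq_trans (card_roots_lt p0)); apply/leq_sizeP => j ltj.
by rewrite coef_map; apply: rj.
Qed.

(** Here s is the outer and t the inner indeterminate. The zeros of f are zeros of the remainder r
    of s^q - s by f. Either some coefficient of r is nonzero at enough values of t to lose zeros, or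
    r = c (t^q - t), and the shift of s by c t makes f a divisor of s^q - s. *)
Lemma planar_monic (f : {poly {poly F}}) (e : nat) :
  (0 < e)%N -> (e < q)%N -> f \is monic -> size f = e.+1 -> tdeg_le e f ->
  (\sum_tau #|[set s | root (f.[s%:P]) tau]| + maxn 1 e.-1 <= e * q)%N \/
  exists c, forall tau s, (f.[(s + c * tau)%:P]).[tau] = (f.[s%:P]).[0].
Proof.
move=> e0 eq monf szf tf.
pose ev tau := map_poly (horner_eval tau : {poly F} -> F).
have evG (g : {poly {poly F}}) tau x : (g.[x]).[tau] = (ev tau g).[x.[tau]].
  by rewrite -[LHS]/(horner_eval tau _) -horner_map.
have evE (g : {poly {poly F}}) tau s : (g.[s%:P]).[tau] = (ev tau g).[s].
  by rewrite evG hornerC.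
pose G : {poly {poly F}} := 'X^q - 'X.
have tG : tdeg_le q G.
  move=> i; rewrite /G coefB coefXn coefX.
  case: eqP => [->|_];
    first by rewrite gtn_eqF ?finNzRing_gt1 // subr0 size_poly1 subSnn.
  case: eqP => [->|_]; last by rewrite subrr size_poly0.
  by rewrite sub0r size_polyN size_poly1 subSS subn0 ltnW // finNzRing_gt1.
have [h [r [GE szr tr]]] := tdeg_division monf szf tf tG.
have rootr tau s : root (ev tau f) s -> root (ev tau r) s.
  rewrite !rootE => /eqP fs; have := evE G tau s.
  have -> : G.[s%:P] = 0 by rewrite /G !hornerE -rmorphXn /= expf_card subrr.
  rewrite horner0 GE.
  by rewrite /ev rmorphD rmorphM !hornerE /= -/(ev tau f) fs mulr0 add0r => <-.
have setE tau : [set s | root (f.[s%:P]) tau] = [set s | root (ev tau f) s].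
  by apply/setP=> s; rewrite !inE rootE evE.
have sub tau : (#|[set s | root (ev tau f) s]| <= #|[set s | root (ev tau r) s]|)%N.
  by apply: subset_leq_card; apply/subsetP=> s; rewrite !inE; apply: rootr.
have szev tau : size (ev tau f) = e.+1.
  by rewrite /ev size_map_poly_id0 ?szf // (monicP monf) rmorph1 oner_neq0.
have Ze tau : (#|[set s | root (ev tau f) s]| <= e)%N.
  have f0 : ev tau f != 0 by rewrite -size_poly_eq0 szev.
  by rewrite -ltnS -(szev tau) card_roots_lt.
under eq_bigr => tau _ do rewrite setE.
case: (boolP [exists i : 'I_e, [exists tau, (r`_i).[tau] != 0]]) => [ex|].
  left.
  have ex' : exists i : nat, (i < e)%N && [exists tau, (r`_i).[tau] != 0].
    by have [i H] := existsP ex; exists i; rewrite ltn_ord.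
  have ub i : (i < e)%N && [exists tau, (r`_i).[tau] != 0] -> (i <= e)%N.
    by case/andP => /ltnW.
  have [i /andP[lti /existsP[tau0 r0]] maxi] := ex_maxnP ex' ub.
  have rj tau j : (i < j)%N -> (r`_j).[tau] = 0.
    move=> lt; case: (ltnP j e) => le;
      last by rewrite nth_default ?horner0 // (leq_trans szr).
    apply/eqP; apply: contraTT lt => rj; rewrite -leqNgt; apply: maxi.
    by rewrite le; apply/existsP; exists tau.
  pose N := #|[set tau | (r`_i).[tau] != 0]|.
  have N1 : (0 < N)%N by apply/card_gt0P; exists tau0; rewrite inE.
  (* The coefficient of s^i in r has degree at most q - i, hence at most q - i roots. *)
  have Ni : (i <= N)%N.
    have ri : r`_i != 0 by apply: contraNneq r0 => ->; rewrite horner0.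
    have := cardsC [set tau | root (r`_i) tau].
    have -> : ~: [set tau | root (r`_i) tau] = [set tau | (r`_i).[tau] != 0].
      by apply/setP => tau; rewrite !inE rootE.
    rewrite -/N => C; have le := leq_trans (card_roots_lt ri) (tr i).
    move: le C; move: #|_| (N) (#|F|) eq => b N' q' *; lia.
  have tot : (\sum_tau #|[set s | root (ev tau f) s]| + (e - i) * N <= e * q)%N.
    have -> : ((e - i) * N)%N =
      (\sum_(tau : F) if ~~ root r`_i tau then (e - i)%N else 0%N).
      rewrite -big_mkcond /= sum_nat_const mulnC; congr (_ * _)%N.
      by apply: eq_card => tau; rewrite !inE.
    have -> : (e * q)%N = (\sum_(tau : F) e)%N by rewrite sum_nat_const mulnC.
    rewrite -big_split /=.
    apply: leq_sum => tau _; case: ifP => H; last by rewrite addn0.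
    have : (#|[set s | root (ev tau f) s]| <= i)%N.
      apply: leq_trans (sub tau) _; apply: root_tdeg => // j; exact: rj.
    by move=> le; rewrite -[X in (_ <= X)%N](subnKC (ltnW lti)) leq_add2r.
  (* The loss is at least (e - i) max(1, i), which is at least max(1, e - 1) for 0 <= i < e. *)
  apply: leq_trans tot; rewrite leq_add2l.
  have : (i * (e - i) <= (e - i) * N)%N by rewrite mulnC leq_mul2l Ni orbT.
  have : (e - i <= (e - i) * N)%N by rewrite leq_pmulr.
  nia.
move=> nex; right.
have rv i tau : (r`_i).[tau] = 0.
  case: (ltnP i e) => le; last by rewrite nth_default ?horner0 // (leq_trans szr).
  apply/eqP; apply: contraNT nex => H; apply/existsP; exists (Ordinal le).
  by apply/existsP; exists tau.
have ri i : (0 < i)%N -> r`_i = 0.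
  by move=> i0; apply: poly_vanish (rv i); apply: leq_trans (tr i) _; lia.
have r0 := poly_vanish_card (tr 0%N) (rv 0%N).
set c := (r`_0)`_q in r0.
have rE : r = (c *: ('X^q - 'X))%:P.
  apply/polyP=> i; rewrite coefC; case: (posnP i) => [->|i0]; first by rewrite -r0.
  by rewrite ri.
exists c.
pose t : {poly {poly F}} := 'X + (c *: 'X)%:P.
(* Since q-th powers are additive, the shift adds exactly c (t^q - t) = r to s^q - s; subtracting r
   leaves a factorization of s^q - s itself. *)
have Gt : G \Po t = G + r.
  rewrite /G comp_polyB rmorphXn /= comp_polyX /t exprDn_pchar; last first.
    rewrite (eq_pnat _ (pchar_poly _)) (eq_pnat _ (pchar_poly _)).
    exact: pchar_nat_card.
  rewrite rE -rmorphXn /= exprZn expf_card scalerBr polyCB; ring.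
have GE' : G = (h \Po t) * (f \Po t).
  by apply: (addIr r);
    rewrite -Gt {1}GE comp_polyD comp_polyM [in r \Po t]rE comp_polyC -rE.
pose G1 : {poly F} := 'X^q - 'X.
have G10 : G1 != 0.
  apply/eqP=> /(congr1 (fun p : {poly F} => p`_q)).
  rewrite /G1 coefB coefXn coefX eqxx gtn_eqF ?finNzRing_gt1 // coef0 subr0.
  by apply/eqP; rewrite oner_eq0.
have swG : swapXY G = G1%:P.
  by rewrite -swapXY_map_polyC; congr swapXY;
    rewrite /G /G1 rmorphB /= map_polyXn map_polyX.
have swE : swapXY (h \Po t) * swapXY (f \Po t) = G1%:P.
  by rewrite -swG GE' rmorphM.
have sw_neq0 : swapXY (h \Po t) * swapXY (f \Po t) != 0 by rewrite swE polyC_eq0.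
(* Seen as a polynomial in t, s^q - s has degree 0, and so has each of its factors. *)
have sz1 : (size (swapXY (f \Po t)) <= 1)%N.
  have := congr1 (fun p : {poly {poly F}} => size p) swE.
  move: sw_neq0; rewrite mulf_eq0 negb_or => /andP[n1 n2].
  rewrite /= size_polyC G10 size_mul //.
  move: n1 n2; rewrite -!size_poly_gt0.
  by move: (size (swapXY (f \Po t))) (size _) => a b /=; lia.
have ftE : f \Po t = map_poly polyC (swapXY (f \Po t))`_0.
  by rewrite -[LHS]swapXYK {1}(size1_polyC sz1) swapXY_polyC.
move=> tau s; set phi := (swapXY _)`_0 in ftE.
have key tau' : (f.[(s + c * tau')%:P]).[tau'] = phi.[s].
  have -> : phi.[s] = (f \Po t).[s%:P].[tau'] by rewrite ftE horner_map hornerC.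
  rewrite horner_comp evE evG; congr (_.[_]).
  by rewrite /t !hornerE.
by rewrite key -(key 0) mulr0 addr0.
Qed.

End Planar.

(** * Restriction of polynomials to lines and to affine subspaces *)

(** Identities between substitutions are checked on constants, variables, sums and products only. *)
Lemma mpoly_gen_ind (R : nzRingType) n (P : {mpoly R[n]} -> Prop) :
  (forall c, P c%:MP) -> (forall i, P 'X_i) ->
  (forall p q, P p -> P q -> P (p + q)) -> (forall p q, P p -> P q -> P (p * q)) ->
  forall p, P p.
Proof.
move=> PC PX PD PM p; have P0 : P 0 by rewrite -mpolyC0.
have P1 : P 1 by rewrite -mpolyC1.
rewrite [p]mpolyE; apply: (big_ind P) => // m _; rewrite -mul_mpolyC; apply: (PM) => //.
rewrite mpolyXE_id; apply: (big_ind P) => // i _.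
by elim: (m i) => [|k IH]; rewrite ?expr0 // exprS; apply: PM.
Qed.

Section Lpoly.
Variables (R : comNzRingType) (k : nat).
Implicit Types (p : {mpoly R[k]}) (x w : 'rV[R]_k).

(* p(x + t w) as a polynomial in t. *)
Definition lpoly x w p : {poly R} :=
  mmap (@polyC R) (fun i => (x 0 i)%:P + w 0 i *: 'X) p.

Lemma lpolyC x w c : lpoly x w c%:MP = c%:P.
Proof. exact: mmapC. Qed.
Lemma lpolyX x w i : lpoly x w 'X_i = (x 0 i)%:P + w 0 i *: 'X.
Proof. by rewrite /lpoly mmapX mmap1U. Qed.
Lemma lpolyD x w : {morph lpoly x w : p q / p + q}.
Proof. exact: mmapD. Qed.
Lemma lpolyM x w : {morph lpoly x w : p q / p * q}.
Proof. exact: rmorphM. Qed.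
Lemma lpoly0 x w : lpoly x w 0 = 0.
Proof. exact: mmap0. Qed.
Lemma lpolyZ x w c p : lpoly x w (c *: p) = c *: lpoly x w p.
Proof. by rewrite -mul_mpolyC lpolyM lpolyC mul_polyC. Qed.
Lemma lpoly_sum x w (I : Type) (r : seq I) (P : pred I) (f : I -> {mpoly R[k]}) :
  lpoly x w (\sum_(i <- r | P i) f i) = \sum_(i <- r | P i) lpoly x w (f i).
Proof. exact: (big_morph _ (lpolyD x w) (lpoly0 x w)). Qed.

Lemma eval_rowD p q x : eval_row (p + q) x = eval_row p x + eval_row q x.
Proof. exact: mevalD. Qed.
Lemma eval_rowM p q x : eval_row (p * q) x = eval_row p x * eval_row q x.
Proof. exact: mevalM. Qed.
Lemma eval_rowC c x : eval_row c%:MP x = c.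
Proof. exact: mevalC. Qed.
Lemma eval_rowX i x : eval_row 'X_i x = x 0 i.
Proof. exact: mevalXU. Qed.
Lemma eval_rowZ c p x : eval_row (c *: p) x = c * eval_row p x.
Proof. exact: mevalZ. Qed.
Lemma eval_row0 x : eval_row 0 x = 0 :> R.
Proof. exact: meval0. Qed.
Lemma eval_row_sum x (I : Type) (r : seq I) (P : pred I) (f : I -> {mpoly R[k]}) :
  eval_row (\sum_(i <- r | P i) f i) x = \sum_(i <- r | P i) eval_row (f i) x.
Proof. exact: (big_morph (fun p => eval_row p x) (fun p q => eval_rowD p q x) (eval_row0 x)). Qed.

Lemma horner_lpoly x w p t : (lpoly x w p).[t] = eval_row p (x + t *: w).
Proof.
elim/mpoly_gen_ind: p => [c|i|p q IHp IHq|p q IHp IHq].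
- by rewrite lpolyC hornerC eval_rowC.
- by rewrite lpolyX eval_rowX !hornerE !mxE mulrC.
- by rewrite lpolyD hornerD IHp IHq eval_rowD.
- by rewrite lpolyM hornerM IHp IHq eval_rowM.
Qed.

(** A formal leading term: [a] may be 0, so that formal degrees add under products. *)
Definition topc (P : {poly R}) (n : nat) (a : R) := (size P <= n.+1)%N /\ P`_n = a.

Lemma topcM P Q n m a b : topc P n a -> topc Q m b -> topc (P * Q) (n + m) (a * b).
Proof.
case=> szP <- [szQ <-]; split.
  apply: (leq_trans (size_polyMleq _ _)); lia.
rewrite coefM (bigD1 (inord n : 'I_(n + m).+1)) //= inordK ?ltnS ?leq_addr //.
rewrite addKn big1 ?addr0 // => i ne.
have {}ne : (i : nat) != n.
  by apply: contra ne => /eqP e; apply/eqP/val_inj; rewrite /= inordK ?ltnS ?leq_addr.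
case: (ltnP n i) => le; first by rewrite nth_default ?mul0r // (leq_trans szP).
by rewrite [Q`__]nth_default ?mulr0 // (leq_trans szQ) //; lia.
Qed.

Lemma topc_mono x w (m : 'X_{1..k}) :
  topc (lpoly x w 'X_[m]) (mdeg m) (eval_row 'X_[m] w).
Proof.
rewrite /lpoly mmapX /mmap1 mdegE /eval_row mevalX.
pose f (i : 'I_k) := ((x 0 i)%:P + w 0 i *: 'X) ^+ m i.
apply: (big_ind3 (fun P n a => topc P n a)) => [||i _].
- by split; rewrite ?size_poly1 ?coefC.
- by move=> x1 x2 x3 y1 y2 y3; apply: topcM.
elim: (m i) => [|j IH]; first by rewrite !expr0; split; rewrite ?size_poly1 ?coefC.
rewrite !exprS; apply: (@topcM _ _ 1 j) => //; split.
  rewrite (leq_trans (size_polyD _ _)) // geq_max (leq_trans (size_polyC_leq1 _)) //.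
  by rewrite (leq_trans (size_scale_leq _ _)) // size_polyX.
by rewrite coefD coefC coefZ coefX /= mulr1 add0r.
Qed.

Lemma size_lpoly x w p D : (msize p <= D.+1)%N -> (size (lpoly x w p) <= D.+1)%N.
Proof.
move=> sz; rewrite [p]mpolyE lpoly_sum big_seq; apply: (leq_trans (size_sum _ _ _)).
apply/bigmax_leqP_seq => m mp _; rewrite lpolyZ (leq_trans (size_scale_leq _ _)) //.
have [le _] := topc_mono x w m; apply: leq_trans le _.
exact: leq_trans (msize_mdeg_lt mp) sz.
Qed.

Lemma coef_lpoly x w p D : (msize p <= D.+1)%N ->
  (lpoly x w p)`_D = eval_row (pihomog mdeg D p) w.
Proof.
move=> sz; rewrite pihomogE [in LHS](mpolyE p) lpoly_sum coef_sum eval_row_sum.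
rewrite [RHS]big_mkcond big_seq [RHS]big_seq; apply: eq_bigr => m mp.
rewrite lpolyZ coefZ /=; have [szm top] := topc_mono x w m.
have := leq_trans (msize_mdeg_lt mp) sz; rewrite ltnS leq_eqVlt.
case/orP=> [/eqP <-|lt]; first by rewrite eqxx eval_rowZ top.
by rewrite ltn_eqF // nth_default ?mulr0 // (leq_trans szm).
Qed.

Lemma msize_homog d p : p \is d.-homog -> (msize p <= d.+1)%N.
Proof.
move/dhomogP=> hp; rewrite msizeE; apply/bigmax_leqP_seq => m mp _.
by rewrite ltnS -(hp _ mp).
Qed.

Lemma coef_lpoly_homog x w p d : p \is d.-homog -> (lpoly x w p)`_d = eval_row p w.
Proof. by move=> hp; rewrite coef_lpoly ?msize_homog // pihomog_dE. Qed.

Lemma deriv_lpoly x w p :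
  (lpoly x w p)^`() = \sum_i w 0 i *: lpoly x w p^`M(i).
Proof.
elim/mpoly_gen_ind: p => [c|i|p q IHp IHq|p q IHp IHq].
- rewrite lpolyC derivC big1 // => i _.
  by rewrite mderivC lpoly0 scaler0.
- rewrite lpolyX derivD derivC add0r derivZ derivX (bigD1 i) //= big1 => [|j ne].
    rewrite mderivX mnm1E eqxx addr0 scale1r.
    have -> : (U_(i) - U_(i) = 0)%MM by apply/mnmP => j; rewrite mnmBE subnn mnm0E.
    by rewrite mpolyX0 -mpolyC1 lpolyC polyC1 alg_polyC.
  by rewrite mderivX mnm1E eq_sym (negPf ne) scale0r lpoly0 scaler0.
- rewrite lpolyD derivD IHp IHq -big_split; apply: eq_bigr => i _ /=.
  by rewrite mderivD lpolyD scalerDr.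
- rewrite lpolyM derivM IHp IHq mulr_suml mulr_sumr -big_split;
    apply: eq_bigr => i _ /=.
  by rewrite mderivM lpolyD !lpolyM scalerDr -!scalerAl -scalerAr.
Qed.

Lemma euler d p : p \is d.-homog -> \sum_i 'X_i * p^`M(i) = p *+ d.
Proof.
move/dhomogP=> hp.
have E (m : 'X_{1..k}) i : 'X_i * ('X_[m])^`M(i) = 'X_[m] *+ m i :> {mpoly R[k]}.
  rewrite mderivX -scalerAr -mpolyXD scaler_nat.
  have [->|m0] := eqVneq (m i) 0%N; first by rewrite !mulr0n.
  by rewrite addmC submK //; apply/mnm_lepP => j; rewrite mnm1E; case: eqP => [<-|];
    lia.
rewrite [p in RHS]mpolyE -sumrMnl.
transitivity (\sum_i \sum_(m <- msupp p) p@_m *: ('X_[m] *+ m i) : {mpoly R[k]}).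
  apply: eq_bigr => i _; rewrite {1}[p]mpolyE linear_sum mulr_sumr.
  by apply: eq_bigr => m _ /=; rewrite linearZ /= -scalerAr E.
rewrite exchange_big big_seq [RHS]big_seq; apply: eq_bigr => m mp /=.
by rewrite -scaler_sumr sumrMnr -mdegE -scalerMnr -(hp _ mp).
Qed.

Lemma homog_mderiv d p i : p \is d.-homog -> p^`M(i) \is d.-1.-homog.
Proof.
move/dhomogP=> hp; rewrite [p]mpolyE linear_sum /= big_seq; apply: rpred_sum => m mp.
rewrite linearZ /= mderivX; apply: rpredZ.
have [->|m0] := eqVneq (m i) 0%N; first by rewrite scale0r rpred0.
apply: rpredZ; rewrite dhomogX /= -(hp _ mp) /=.
have le : (U_(i) <= m)%MM.
  by apply/mnm_lepP => j; rewrite mnm1E; case: eqP => [<-|]; lia.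
by rewrite -{2}(submK le) mdegD mdeg1 addn1.
Qed.

(** Compare the coefficients of t^(d-1) in Euler's identity along the line. The terms in [w] form
    the coefficient of the derivative and contribute d - 1 copies of the left-hand side, out of d;
    no division by d occurs, so the characteristic is arbitrary. *)
Lemma coef_lpoly_pred x w p d : (0 < d)%N -> p \is d.-homog ->
  (lpoly x w p)`_d.-1 = \sum_i x 0 i * eval_row p^`M(i) w.
Proof.
move=> d0 hp; have := congr1 (fun f => (lpoly x w f)`_d.-1) (euler hp).
rewrite -scaler_nat lpolyZ coefZ lpoly_sum coef_sum.
under eq_bigr => i _ do rewrite lpolyM lpolyX mulrDl coefD coefCM -scalerAl coefZ
  coefXM.
rewrite big_split /=.
under eq_bigr => i _ do rewrite (coef_lpoly_homog _ _ (homog_mderiv i hp)).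
move: (\sum_(i < k) x 0 i * _) => S.
have -> : \sum_(i < k) w 0 i * (if d.-1 == 0%N then 0 else (lpoly x w p^`M(i))`_d.-2) =
   (lpoly x w p)`_d.-1 *+ d.-1.
  case: (d.-1) => [|j]; first by rewrite big1 // => i _; rewrite mulr0.
  rewrite -coef_deriv deriv_lpoly coef_sum; apply: eq_bigr => i _.
  by rewrite coefZ.
set y := (lpoly x w p)`_d.-1; rewrite mulr_natl => E.
by apply: (addIr (y *+ d.-1)); rewrite E -mulrS prednK.
Qed.

End Lpoly.

(** * Counting zeros along parallel lines *)

Section Direction.
Variable F : finFieldType.
Local Notation q := #|F|.

(** Degree q is allowed thanks to homogeneity: the coefficient of the d-th power of the last
    variable is the value at the last coordinate point, so the degree in that variable is below q.
    Induction then treats the other coefficients. *)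
Lemma homog_vanish k (f : {mpoly F[k]}) d : (d <= q)%N -> f \is d.-homog ->
  (forall x : 'I_k -> F, f.@[x] = 0) -> f = 0.
Proof.
elim: k f d => [|k IH] f d le hf f0.
  have fc : f = (f@_0)%:MP.
    apply/mpolyP=> m; have -> : m = 0%MM by apply/mnmP; case.
    by rewrite mcoeffC eqxx mulr1.
  have := f0 (fun _ => 0); rewrite fc mevalC => ->; exact: mpolyC0.
pose cst (x : 'I_k -> F) s : 'I_k.+1 -> F :=
  fun j => if unlift ord_max j is Some j' then x j' else s.
have cst_max x s : cst x s ord_max = s by rewrite /cst unlift_none.
have cst_w x s j : (cst x s \o widen_ord (leqnSn k)) j = x j.
  rewrite /cst /=; have -> : widen_ord (leqnSn k) j = lift ord_max j.
    by apply: val_inj; rewrite /= /bump leqNgt ltn_ord.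
  by rewrite liftK.
have fE x s : f.@[cst x s] = \sum_(i < d.+1) (last_coef f i).@[x] * s ^+ i.
  rewrite {1}(last_coefE hf) (big_morph _ (mevalD _) (meval0 _)); apply: eq_bigr => i _.
  rewrite mevalM meval_mwiden (meval_eq _ (cst_w x s)); congr (_ * _).
  by rewrite rmorphXn /= mevalXU cst_max.
pose P x : {poly F} := \poly_(i < d.+1) (last_coef f i).@[x].
have Pd x : (P x)`_d = 0.
  rewrite coef_poly ltnSn.
  have h0 := last_coef_homog d hf; rewrite subnn in h0.
  rewrite (homog0_const h0) mevalC; move: (fE (fun _ => 0) 1); rewrite f0.
  rewrite big_ord_recr /= big1 => [|i _].
    by rewrite add0r expr1n mulr1 {1}(homog0_const h0) mevalC.
  by rewrite (homog_meval0 (last_coef_homog i hf)) ?mul0r // subn_gt0.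
have Ps x s : (P x).[s] = 0 by rewrite horner_poly -fE f0.
have P0 x : P x = 0.
  apply: poly_vanish (Ps x); apply: leq_trans le.
  apply/leq_sizeP => j; rewrite leq_eqVlt => /orP[/eqP <- //|lt].
  by rewrite coef_poly ltnNge lt.
rewrite (last_coefE hf) big1 // => i _.
rewrite (IH (last_coef f i) (d - i)%N) ?mwiden0 ?mul0r //.
- by rewrite (leq_trans (leq_subr _ _)).
- exact: last_coef_homog.
by move=> x; have := congr1 (fun p : {poly F} => p`_i) (P0 x);
  rewrite coef_poly ltn_ord coef0.
Qed.

Lemma eval_row_vanish k (f : {mpoly F[k]}) d : (d <= q)%N -> f \is d.-homog ->
  (forall x, eval_row f x = 0) -> f = 0.
Proof.
move=> le hf f0; apply: (homog_vanish le hf) => x.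
rewrite -[RHS](f0 (\row_i x i)); apply: meval_eq => i.
by rewrite mxE.
Qed.

Lemma pihomog_top_neq0 k (f : {mpoly F[k]}) : f != 0 -> pihomog mdeg (msize f).-1 f != 0.
Proof.
move=> f0; apply/eqP=> /(congr1 (mcoeff (mlead f)));
  rewrite mcoeff0 pihomogE raddf_sum /=.
rewrite (big_rem (mlead f)) ?mlead_supp //= -mlead_deg //= eqxx mcoeffZ mcoeffX eqxx
  mulr1.
rewrite big_seq_cond big1 ?addr0; first by move/eqP; rewrite mleadc_eq0 (negPf f0).
move=> m /andP[]; rewrite mem_rem_uniq ?msupp_uniq // inE => /andP[ne _] _.
by rewrite mcoeffZ mcoeffX (negPf ne) mulr0.
Qed.

(* The leading form does not vanish at w, so every line with direction w
   sees the full degree of f. *)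
Lemma direction k (f : {mpoly F[k]}) : f != 0 -> (msize f <= q.+1)%N ->
  exists w, forall x, size (lpoly x w f) = msize f.
Proof.
move=> f0 sz; have sf : (msize f).-1.+1 = msize f by rewrite prednK // lt0n
  msize_poly_eq0.
have [w fw] : exists w, eval_row (pihomog mdeg (msize f).-1 f) w != 0.
  apply/existsP; apply: contraT => /existsPn H.
  case/eqP: (pihomog_top_neq0 f0); apply: (@eval_row_vanish _ _ (msize f).-1).
  - by rewrite -ltnS sf.
  - exact: pihomogP.
  by move=> x; have /negPn/eqP := H x.
exists w => x; apply/eqP;
  rewrite eqn_leq -[X in (_ <= X <= _)%N]sf size_lpoly ?sf //= -sf ltnNge.
by apply: contra fw => /leq_sizeP/(_ _ (leqnn _)); rewrite coef_lpoly ?sf // => ->.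
Qed.

Lemma sum_lines k (S : {set 'rV[F]_k}) (w : 'rV[F]_k) :
  (\sum_x #|[set t | (x + t *: w)%R \in S]| = q * #|S|)%N.
Proof.
rewrite (eq_bigr (fun x => \sum_(t : F) ((x + t *: w)%R \in S)%N)%N); last first.
  by move=> x _; rewrite -sum1_card big_mkcond; apply: eq_bigr => t _; rewrite inE;
    case: (_ \in _).
rewrite exchange_big /= (eq_bigr (fun=> #|S|)) ?sum_nat_const // => t _.
rewrite (reindex_inj (addIr (- (t *: w)))) /= -sum1_card [RHS]big_mkcond.
by apply: eq_bigr => x _; rewrite subrK; case: (_ \in _).
Qed.

Lemma card_rV k : #|{: 'rV[F]_k}| = (q ^ k)%N.
Proof. by rewrite card_mx mul1n. Qed.

Lemma lines_bound k (S : {set 'rV[F]_k}) w D :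
  (forall x, #|[set t | (x + t *: w)%R \in S]| <= D)%N -> (q * #|S| <= D * q ^ k)%N.
Proof.
move=> H; rewrite -(sum_lines S w) -card_rV mulnC -sum_nat_const.
by apply: leq_sum.
Qed.

Definition zeros k (f : {mpoly F[k]}) : {set 'rV[F]_k} := [set y | eval_row f y == 0].

Lemma line_roots k (f : {mpoly F[k]}) x w : lpoly x w f != 0 ->
  (#|[set t | (x + t *: w)%R \in zeros f]| <= (size (lpoly x w f)).-1)%N.
Proof.
move=> f0; rewrite -ltnS prednK ?size_poly_gt0 //; apply: leq_trans (card_roots_lt f0).
rewrite ltnS; apply: subset_leq_card; apply/subsetP => t; rewrite !inE rootE.
by rewrite horner_lpoly.
Qed.

(** In the direction given by [direction] no line lies in the zero set, so each of the parallel
    lines has at most [D] zeros. *)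
Lemma zeros_bound k (f : {mpoly F[k]}) D : (msize f <= q.+1)%N ->
  (forall x w, (size (lpoly x w f) <= D.+1)%N) -> f != 0 ->
  (q * #|zeros f| <= D * q ^ k)%N.
Proof.
move=> sz szD f0; have [w wE] := direction f0 sz.
apply: (@lines_bound _ _ w) => x; apply: leq_trans (line_roots _) _.
  by rewrite -size_poly_gt0 wE lt0n msize_poly_eq0.
by have := szD x w; case: (size _).
Qed.

Lemma msize_le_lines k (f : {mpoly F[k]}) D : (msize f <= q.+1)%N ->
  (forall x w, (size (lpoly x w f) <= D)%N) -> (msize f <= D)%N.
Proof.
move=> sz szD; have [->|f0] := eqVneq f 0; first by rewrite msize0.
by have [w wE] := direction f0 sz; rewrite -(wE 0).
Qed.

(** Take a direction in which all lines see the full degree. On one such line f is a constant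
    function of degree below q, hence a constant polynomial, so f has degree 0. *)
Lemma const_lines k (f : {mpoly F[k]}) : (msize f <= q)%N ->
  (forall w, exists x, forall t, eval_row f (x + t *: w) = eval_row f x) ->
  forall x y, eval_row f x = eval_row f y.
Proof.
move=> sz H; suff fc : f = (f@_0)%:MP by move=> x y; rewrite fc !eval_rowC.
have [->|f0] := eqVneq f 0; first by rewrite mcoeff0 mpolyC0.
have [w wE] := direction f0 (leqW sz); have [x xE] := H w.
apply: msize1_polyC; rewrite -(wE x).
suff -> : lpoly x w f = (eval_row f x)%:P by rewrite size_polyC leq_b1.
apply/eqP; rewrite -subr_eq0; apply/eqP; apply: poly_vanish => [|t].
  rewrite (leq_trans (size_polyD _ _)) // geq_max wE sz size_polyN.
  by rewrite (leq_trans (size_polyC_leq1 _)) // ltnW // finNzRing_gt1.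
by rewrite !hornerE horner_lpoly xE subrr.
Qed.

End Direction.

Section AffineSubst.
Variables (R : comNzRingType) (j k : nat).
Implicit Types (v : 'rV[R]_k) (A : 'M[R]_(j, k)) (p : {mpoly R[k]}).

(* The polynomial p(v + y *m A) in the indeterminates y. *)
Definition asub v A p : {mpoly R[j]} :=
  p \mPo [tuple (v 0 i)%:MP + \sum_(l < j) A l i *: 'X_l | i < k].

Lemma asubC v A c : asub v A c%:MP = c%:MP.
Proof. exact: comp_mpolyC. Qed.
Lemma asubX v A i : asub v A 'X_i = (v 0 i)%:MP + \sum_(l < j) A l i *: 'X_l.
Proof. by rewrite /asub comp_mpolyXU -tnth_nth tnth_mktuple. Qed.
Lemma asubD v A : {morph asub v A : p q / p + q}.
Proof. exact: comp_mpolyD. Qed.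
Lemma asubM v A : {morph asub v A : p q / p * q}.
Proof. exact: rmorphM. Qed.
Lemma asubZ v A c p : asub v A (c *: p) = c *: asub v A p.
Proof. exact: comp_mpolyZ. Qed.
Lemma asub0 v A : asub v A 0 = 0.
Proof. exact: comp_mpoly0. Qed.
Lemma asub_sum v A (I : Type) (r : seq I) (P : pred I) (f : I -> {mpoly R[k]}) :
  asub v A (\sum_(i <- r | P i) f i) = \sum_(i <- r | P i) asub v A (f i).
Proof. exact: (big_morph _ (asubD v A) (asub0 v A)). Qed.

Lemma eval_asub v A p (y : 'rV_j) : eval_row (asub v A p) y = eval_row p (v + y *m A).
Proof.
elim/mpoly_gen_ind: p => [c|i|p q IHp IHq|p q IHp IHq].
- by rewrite asubC !eval_rowC.
- rewrite asubX eval_rowD eval_rowC !eval_rowX !mxE eval_row_sum; congr (_ + _).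
  by apply: eq_bigr => l _; rewrite eval_rowZ eval_rowX mulrC.
- by rewrite asubD !eval_rowD IHp IHq.
- by rewrite asubM !eval_rowM IHp IHq.
Qed.

Lemma lpoly_asub v A p (y w : 'rV_j) :
  lpoly y w (asub v A p) = lpoly (v + y *m A) (w *m A) p.
Proof.
elim/mpoly_gen_ind: p => [c|i|p q IHp IHq|p q IHp IHq].
- by rewrite asubC !lpolyC.
- rewrite asubX lpolyD lpolyC !lpolyX !mxE lpoly_sum polyCD -addrA; congr (_ + _).
  rewrite rmorph_sum /= scaler_suml -big_split; apply: eq_bigr => l _ /=.
  by rewrite lpolyZ lpolyX scalerDr scalerA -mul_polyC -polyCM mulrC [w 0 l * _]mulrC.
- by rewrite asubD !lpolyD IHp IHq.
- by rewrite asubM !lpolyM IHp IHq.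
Qed.

Lemma asub_mono v A (m : 'X_{1..k}) :
  asub v A 'X_[m] = \prod_i ((v 0 i)%:MP + \sum_(l < j) A l i *: 'X_l) ^+ m i.
Proof.
by rewrite /asub comp_mpolyX; apply: eq_bigr => i _; rewrite tnth_mktuple.
Qed.

Lemma msizeM_bound (f g : {mpoly R[j]}) a b :
  (msize f <= a.+1)%N -> (msize g <= b.+1)%N -> (msize (f * g) <= (a + b).+1)%N.
Proof.
move=> Hf Hg; rewrite msizeE;
  apply/bigmax_leqP_seq => m /msuppM_le/allpairsP[[m1 m2] /=].
case=> /msize_mdeg_lt lt1 /msize_mdeg_lt lt2 -> _; rewrite mdegD.
by rewrite ltnS leq_add // -ltnS ?(leq_trans lt1) ?(leq_trans lt2).
Qed.

Lemma msize_sum_bound (I : Type) (r : seq I) (P : pred I) (f : I -> {mpoly R[j]}) D :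
  (forall i, P i -> (msize (f i) <= D)%N) -> (msize (\sum_(i <- r | P i) f i) <= D)%N.
Proof.
move=> H; apply: (big_ind (fun g => msize g <= D)%N) => //; first by rewrite msize0.
by move=> f1 f2 H1 H2; rewrite (leq_trans (msizeD_le _ _)) // geq_max H1 H2.
Qed.

Lemma msize_asub v A p D : (msize p <= D.+1)%N -> (msize (asub v A p) <= D.+1)%N.
Proof.
move=> sz; rewrite [p]mpolyE asub_sum big_seq; apply: msize_sum_bound => m mp.
rewrite asubZ (leq_trans (msizeZ_le _ _)) //.
apply: leq_trans (leq_trans (msize_mdeg_lt mp) sz).
rewrite asub_mono mdegE; apply: (big_ind2 (fun f n => msize f <= n.+1)%N).
- by rewrite msize1.
- by move=> f1 n1 f2 n2; apply: msizeM_bound.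
move=> i _; elim: (m i) => [|n IH]; first by rewrite expr0 msize1.
rewrite exprS; apply: (@msizeM_bound _ _ 1 n) => //.
rewrite (leq_trans (msizeD_le _ _)) // geq_max; apply/andP; split.
  by rewrite msizeC; case: (_ == _).
by apply: msize_sum_bound => l _; rewrite (leq_trans (msizeZ_le _ _)) // msizeX mdeg1.
Qed.

Lemma homog_asub A p d : p \is d.-homog -> asub 0 A p \is d.-homog.
Proof.
move/dhomogP=> hp; rewrite [p]mpolyE asub_sum big_seq; apply: rpred_sum => m mp.
rewrite asubZ; apply: rpredZ; rewrite -(hp _ mp) /= asub_mono mdegE.
apply: (big_ind2 (fun (f : {mpoly R[j]}) n => f \is n.-homog)).
- exact: dhomog1.
- by move=> f1 n1 f2 n2; apply: dhomogM.
move=> i _; rewrite -[X in X.-homog]mul1n; apply: dhomogMn.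
rewrite mxE mpolyC0 add0r; apply: rpred_sum => l _; apply: rpredZ.
by rewrite dhomogX /= mdeg1.
Qed.

Lemma mderiv_asub v A p l :
  (asub v A p)^`M(l) = \sum_i A l i *: asub v A p^`M(i).
Proof.
have derX n (i i' : 'I_n) : ('X_i)^`M(i') = (i == i')%:R :> {mpoly R[n]}.
  rewrite mderivX mnm1E; case: eqP => [->|_]; last by rewrite scale0r.
  rewrite scale1r; have -> : (U_(i') - U_(i') = 0)%MM; last exact: mpolyX0.
  by apply/mnmP => i2; rewrite mnmBE subnn mnm0E.
elim/mpoly_gen_ind: p => [c|i|p q IHp IHq|p q IHp IHq].
- by rewrite asubC mderivC big1 // => i _; rewrite mderivC asub0 scaler0.
- rewrite asubX mderivD mderivC add0r raddf_sum /= (bigD1 l) //= big1 => [|l' ne];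
    last first.
    by rewrite linearZ /= derX (negPf ne) scaler0.
  rewrite linearZ /= derX eqxx (bigD1 i) //= big1 => [|i' ne]; last first.
    by rewrite derX eq_sym (negPf ne) asub0 scaler0.
  by rewrite derX eqxx -mpolyC1 asubC.
- rewrite asubD mderivD IHp IHq -big_split; apply: eq_bigr => i _ /=.
  by rewrite mderivD asubD scalerDr.
- rewrite asubM mderivM IHp IHq mulr_suml mulr_sumr -big_split;
    apply: eq_bigr => i _ /=.
  by rewrite mderivM asubD !asubM scalerDr -!scalerAl -scalerAr.
Qed.

End AffineSubst.

Lemma map_asub (R S : comNzRingType) (phi : {rmorphism R -> S}) j k (v : 'rV[R]_k)
    (A : 'M[R]_(j, k)) p :
  map_mpoly phi (asub v A p) = asub (map_mx phi v) (map_mx phi A) (map_mpoly phi p).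
Proof.
elim/mpoly_gen_ind: p => [c|i|p q IHp IHq|p q IHp IHq].
- by rewrite asubC !map_mpolyC asubC.
- rewrite asubX map_mpolyX asubX rmorphD /= map_mpolyC mxE rmorph_sum /=; congr (_ + _).
  by apply: eq_bigr => l _; rewrite map_mpolyZ map_mpolyX mxE.
- by rewrite asubD !rmorphD /= asubD IHp IHq.
- by rewrite asubM !rmorphM /= asubM IHp IHq.
Qed.

Lemma map_mderiv (R S : comNzRingType) (phi : {rmorphism R -> S}) k (p : {mpoly R[k]}) i :
  map_mpoly phi p^`M(i) = (map_mpoly phi p)^`M(i).
Proof.
by apply/mpolyP=> m; rewrite mcoeff_map_mpoly !mcoeff_deriv mcoeff_map_mpoly raddfMn.
Qed.

Lemma eval_row_map (R S : comNzRingType) (phi : {rmorphism R -> S}) k (p : {mpoly R[k]}) x :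
  eval_row (map_mpoly phi p) (map_mx phi x) = phi (eval_row p x).
Proof.
elim/mpoly_gen_ind: p => [c|i|p q IHp IHq|p q IHp IHq].
- by rewrite map_mpolyC !eval_rowC.
- by rewrite map_mpolyX !eval_rowX mxE.
- by rewrite rmorphD /= !eval_rowD rmorphD /= IHp IHq.
- by rewrite rmorphM /= !eval_rowM rmorphM /= IHp IHq.
Qed.

Lemma restrictE (F : finFieldType) j k (A : 'M[F]_(j, k)) p :
  restrict A p = asub 0 A p.
Proof.
elim/mpoly_gen_ind: p => [c|i|p q IHp IHq|p q IHp IHq].
- by rewrite asubC /restrict comp_mpolyC.
- by rewrite asubX /restrict comp_mpolyXU -tnth_nth tnth_mktuple mxE mpolyC0 add0r.
- by rewrite asubD -IHp -IHq /restrict comp_mpolyD.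
- by rewrite asubM -IHp -IHq /restrict rmorphM.
Qed.

(** * Polynomials in two variables on planes *)

Section Plane.
Variable F : finFieldType.
Local Notation q := #|F|.

Lemma sum_affine j k (S : {set 'rV[F]_k}) (U : 'M[F]_(j, k)) :
  (\sum_x #|[set t : 'rV_j | (x + t *m U)%R \in S]| = q ^ j * #|S|)%N.
Proof.
rewrite (eq_bigr (fun x => \sum_(t : 'rV_j) ((x + t *m U)%R \in S)%N)%N); last first.
  by move=> x _; rewrite -sum1_card big_mkcond; apply: eq_bigr => t _; rewrite inE;
    case: (_ \in _).
rewrite exchange_big /= (eq_bigr (fun=> #|S|)) => [|t _].
  by rewrite sum_nat_const card_rV.
rewrite (reindex_inj (addIr (- (t *m U)))) /= -sum1_card [RHS]big_mkcond.
by apply: eq_bigr => x _; rewrite subrK; case: (_ \in _).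
Qed.

Definition row2 (a b : F) : 'rV[F]_2 := \row_i (if i == 0 then a else b).

Definition mx2 k (u w : 'rV[F]_k) : 'M[F]_(2, k) :=
  \matrix_(i, j) (if i == 0 then u else w) 0 j.

Lemma row2_mx2 k (u w : 'rV[F]_k) a b : row2 a b *m mx2 u w = a *: u + b *: w.
Proof. by apply/rowP=> i; rewrite !mxE !big_ord_recl big_ord0 !mxE /= addr0. Qed.

(** Variable 0 becomes the inner indeterminate t, variable 1 the outer one s. *)
Definition biv (f : {mpoly F[2]}) : {poly {poly F}} :=
  mmap (polyC \o polyC) (fun i => if i == 0 then 'X%:P else 'X) f.

Lemma bivC c : biv c%:MP = c%:P%:P. Proof. exact: mmapC. Qed.
Lemma bivX i : biv 'X_i = if i == 0 then 'X%:P else 'X.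
Proof. by rewrite /biv mmapX mmap1U. Qed.
Lemma bivD : {morph biv : f g / f + g}. Proof. exact: mmapD. Qed.
Lemma bivM : {morph biv : f g / f * g}. Proof. exact: rmorphM. Qed.
Lemma biv0 : biv 0 = 0. Proof. exact: mmap0. Qed.

Lemma horner_biv f s t : ((biv f).[s%:P]).[t] = eval_row f (row2 t s).
Proof.
elim/mpoly_gen_ind: f => [c|i|f g IHf IHg|f g IHf IHg].
- by rewrite bivC !hornerC eval_rowC.
- by rewrite bivX eval_rowX mxE; case: eqP; rewrite !hornerE.
- by rewrite bivD !hornerD IHf IHg eval_rowD.
- by rewrite bivM !hornerM IHf IHg eval_rowM.
Qed.

Lemma biv_ev0 f : map_poly (horner_eval 0) (biv f) = lpoly 0 (row2 0 1) f.
Proof.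
elim/mpoly_gen_ind: f => [c|i|f g IHf IHg|f g IHf IHg].
- by rewrite bivC lpolyC map_polyC /= /horner_eval hornerC.
- rewrite bivX lpolyX !mxE add0r; case: eqP => _; last by rewrite map_polyX scale1r.
  by rewrite map_polyC /= /horner_eval hornerX scale0r.
- by rewrite bivD rmorphD /= IHf IHg lpolyD.
- by rewrite bivM rmorphM /= IHf IHg lpolyM.
Qed.

Lemma tdeg_biv f e : (msize f <= e.+1)%N -> tdeg_le e (biv f).
Proof.
move=> sz i; rewrite [f]mpolyE (big_morph biv bivD biv0) coef_sum big_seq.
apply: (leq_trans (size_sum _ _ _)); apply/bigmax_leqP_seq => m mf _.
rewrite -mul_mpolyC bivM bivC.
have -> : biv 'X_[m] = ('X^(m 0))%:P * 'X^(m (lift 0 0)).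
  rewrite /biv mmapX /mmap1 !big_ord_recl big_ord0 /= mulr1 rmorphXn /=; congr (_ * _).
rewrite !coefCM coefXn; case: eqP => [iE|_]; last by rewrite !mulr0 size_poly0.
rewrite mulr1 mul_polyC (leq_trans (size_scale_leq _ _)) // size_polyXn.
have := leq_trans (msize_mdeg_lt mf) sz; rewrite mdegE !big_ord_recl big_ord0.
rewrite iE addn0; change (m 0) with (m ord0).
by move: (m ord0) (m (lift ord0 ord0)) => x y; lia.
Qed.

(** Total degree at most [e] makes the coefficient of s^e a constant, nonzero by hypothesis;
    dividing by it reduces to [planar_monic]. *)
Lemma planar (f : {mpoly F[2]}) e : (0 < e)%N -> (e < q)%N -> (msize f <= e.+1)%N ->
  (lpoly 0 (row2 0 1) f)`_e != 0 ->
  (#|zeros f| + maxn 1 e.-1 <= e * q)%N \/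
  exists c, forall t s, eval_row f (row2 t (s + c * t)) = eval_row f (row2 0 s).
Proof.
move=> e0 eq sz; set a := _`_e => a0.
have tf := tdeg_biv sz.
have lead : (biv f)`_e = a%:P.
  have := tf e; rewrite subSnn => /size1_polyC ->; congr _%:P.
  rewrite -horner_coef0 -[LHS]/(horner_eval 0 _) -coef_map.
  by rewrite [map_poly _ _]biv_ev0.
pose g := (a^-1)%:P%:P * biv f.
have gE i : g`_i = a^-1 *: (biv f)`_i by rewrite /g coefCM mul_polyC.
have ge : g`_e = 1 by rewrite gE lead -mul_polyC -polyCM mulVf.
have szg : size g = e.+1.
  apply/eqP; rewrite eqn_leq; apply/andP; split.
    apply/leq_sizeP => j lt; rewrite gE; apply/eqP; rewrite scaler_eq0; apply/orP;
      right.
    by rewrite -size_poly_leq0 (leq_trans (tf j)) // leqn0 subn_eq0.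
  by rewrite ltnNge; apply/negP=> /leq_sizeP/(_ _ (leqnn _))/eqP; rewrite ge oner_eq0.
have mong : g \is monic by rewrite monicE lead_coefE szg ge.
have tg : tdeg_le e g by move=> i; rewrite gE (leq_trans (size_scale_leq _ _)).
have hg s t : (g.[s%:P]).[t] = a^-1 * eval_row f (row2 t s).
  by rewrite /g !hornerE horner_biv.
have ai : a^-1 != 0 by rewrite invr_neq0.
case: (planar_monic e0 eq mong szg tg) => [H|[c H]]; [left|right]; last first.
  by exists c => t s; apply: (mulfI ai); rewrite -!hg H.
apply: leq_trans H; rewrite leq_add2r -sum1_card.
rewrite (eq_bigr (fun t => \sum_(s : F) (row2 t s \in zeros f)%N)%N); last first.
  move=> t _; rewrite -sum1_card big_mkcond; apply: eq_bigr => s _.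
  by rewrite !inE rootE hg mulf_eq0 (negPf ai); case: (_ == _).
rewrite pair_big /= big_mkcond (reindex (fun x : F * F => row2 x.1 x.2)) /=.
  by apply: eq_leq; apply: eq_bigr => x _; case: (_ \in _).
exists (fun r => (r 0 0, r 0 1)) => [[t s] _|r _] /=; first by rewrite !mxE.
apply/rowP=> i; rewrite mxE; case: eqP => [-> //|ne]; congr (r _ _); apply: val_inj.
by case: i ne => [[|[|m]] lt] //= ne; case: ne; apply: val_inj.
Qed.

End Plane.

(** * Slices of a hypersurface by the cosets of a linear subspace *)

Lemma eval_homogZ (R : comNzRingType) k d (p : {mpoly R[k]}) c x :
  p \is d.-homog -> eval_row p (c *: x) = c ^+ d * eval_row p x.
Proof.
move/dhomogP=> hp; rewrite [p]mpolyE !eval_row_sum mulr_sumr big_seq [RHS]big_seq.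
apply: eq_bigr => m mp; rewrite !eval_rowZ mulrCA; congr (_ * _).
rewrite /eval_row !mevalX -(hp _ mp) /= mdegE -prodrXr -big_split;
  apply: eq_bigr => i _ /=.
by rewrite mxE exprMn.
Qed.

(** The differential of p at [u] applied to [x]; as a function of [u] it is the form G_x. *)
Definition dirder (R : comNzRingType) k (p : {mpoly R[k]}) (u x : 'rV[R]_k) : R :=
  \sum_i x 0 i * eval_row p^`M(i) u.

Section Dirder.
Variables (R : comNzRingType) (k : nat) (p : {mpoly R[k]}).
Implicit Types u x y : 'rV[R]_k.

Lemma dirderD u x y : dirder p u (x + y) = dirder p u x + dirder p u y.
Proof. by rewrite -big_split; apply: eq_bigr => i _; rewrite mxE mulrDl. Qed.

Lemma dirderZ u c x : dirder p u (c *: x) = c * dirder p u x.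
Proof. by rewrite mulr_sumr; apply: eq_bigr => i _; rewrite mxE mulrA. Qed.

Lemma dirder_homog d c u x : p \is d.-homog ->
  dirder p (c *: u) x = c ^+ d.-1 * dirder p u x.
Proof.
move=> hp; rewrite mulr_sumr; apply: eq_bigr => i _.
by rewrite (eval_homogZ _ _ (homog_mderiv i hp)) mulrCA.
Qed.

Lemma dirder_self d u : p \is d.-homog -> dirder p u u = eval_row p u *+ d.
Proof.
move=> hp; rewrite -mulr_natl -eval_rowZ scaler_nat -(euler hp) eval_row_sum.
by apply: eq_bigr => i _; rewrite eval_rowM eval_rowX.
Qed.

End Dirder.

Section Slices.
Variables (F : finFieldType) (k d l : nat) (p : {mpoly F[k]}) (A : 'M[F]_(l, k)).
Local Notation q := #|F|.
Local Notation ev := (eval_row p).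
Local Notation D := (dirder p).
Local Notation e := d.-1.
Hypotheses (hp : p \is d.-homog) (d2 : (2 <= d)%N) (dq : (d <= q)%N).
Hypothesis hL : forall y : 'rV_l, ev (y *m A) = 0.

Let d_gt0 : (0 < d)%N. Proof. exact: ltnW. Qed.
Let e_gt0 : (0 < e)%N. Proof. by rewrite -ltnS prednK. Qed.
Let eS : e.+1 = d. Proof. exact: prednK. Qed.

(** The coefficient of t^d is the value of p at the direction, a vector of L. *)
Lemma size_lpoly_slice x (w : 'rV_l) : (size (lpoly x (w *m A) p) <= d)%N.
Proof.
apply/leq_sizeP => j; rewrite leq_eqVlt => /orP[/eqP <-|lt].
  by rewrite (coef_lpoly_homog _ _ hp) hL.
by rewrite nth_default // (leq_trans (size_lpoly _ _ (msize_homog hp))).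
Qed.

Lemma coef_lpoly_slice x w : (lpoly x w p)`_e = D w x.
Proof. exact: coef_lpoly_pred. Qed.

Lemma dirder_slice (u y : 'rV_l) : D (u *m A) (y *m A) = 0.
Proof.
rewrite -coef_lpoly_slice; suff -> : lpoly (y *m A) (u *m A) p = 0 by rewrite coef0.
apply: poly_vanish => [|t]; first exact: leq_trans (size_lpoly_slice _ _) dq.
by rewrite horner_lpoly scalemxAl -mulmxDl hL.
Qed.

Definition slice v := asub v A p.

Lemma eval_slice v y : eval_row (slice v) y = ev (v + y *m A).
Proof. exact: eval_asub. Qed.

Lemma size_lpoly_of_slice v y w : (size (lpoly y w (slice v)) <= d)%N.
Proof. by rewrite lpoly_asub size_lpoly_slice. Qed.

Lemma coef_lpoly_of_slice v y w : (lpoly y w (slice v))`_e = D (w *m A) v.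
Proof. by rewrite lpoly_asub coef_lpoly_slice dirderD dirder_slice addr0. Qed.

Lemma msize_slice_lt v : (msize (slice v) <= q.+1)%N.
Proof.
by apply: leq_trans (msize_asub _ _ (msize_homog hp)) _; rewrite ltnS.
Qed.

Lemma msize_slice v : (msize (slice v) <= d)%N.
Proof. by apply: msize_le_lines (msize_slice_lt v) _ => y w;
  apply: size_lpoly_of_slice. Qed.

(** G_v = 0 on L; equivalently, [v] lies in the tangent spaces at all points of L. *)
Definition inker v := [forall u : 'rV_l, D (u *m A) v == 0].

Lemma zeros_noker v : ~~ inker v -> (q * #|zeros (slice v)| <= e * q ^ l)%N.
Proof.
move=> /forallPn[u Du]; apply: zeros_bound (msize_slice_lt v) _ _ => [y w|].
  by rewrite eS size_lpoly_of_slice.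
by apply: contraNneq Du => s0; rewrite -(coef_lpoly_of_slice v 0) s0 lpoly0 coef0.
Qed.

Lemma zeros_ker v : inker v -> slice v != 0 -> (q * #|zeros (slice v)| <= e.-1 * q ^ l)%N.
Proof.
move=> /forallP ker; apply: zeros_bound (msize_slice_lt v) _ => y w.
rewrite prednK //; apply/leq_sizeP => j; rewrite leq_eqVlt => /orP[/eqP <-|lt].
  by rewrite coef_lpoly_of_slice; apply/eqP.
by rewrite nth_default // (leq_trans (size_lpoly_of_slice _ _ _)) // -eS.
Qed.

(** The second alternative of [planar] on some plane parallel to [u] and [u1]: there p(v + y) is
    constant in the direction u1 + c u. *)
Definition extremal v := forall u u1 : 'rV_l, D (u *m A) v != 0 ->
  exists y0 c, forall t s,
    ev (v + (y0 + t *: (u1 + c *: u) + s *: u) *m A) = ev (v + (y0 + s *: u) *m A).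

(** If for one pair of directions the first alternative of [planar] holds on all parallel planes,
    averaging over these planes gives the bound. *)
Lemma extremal_dichotomy v :
  (q ^ 2 * #|zeros (slice v)| + maxn 1 e.-1 * q ^ l <= e * q * q ^ l)%N \/ extremal v.
Proof.
pose f u u1 y0 := asub y0 (mx2 u1 u) (slice v).
case: (boolP [exists u : 'rV_l, [exists u1 : 'rV_l, (D (u *m A) v != 0) &&
    [forall y0, #|zeros (f u u1 y0)| + maxn 1 e.-1 <= e * q]%N]]) => [|H].
  case/existsP=> u /existsP[u1 /andP[Du /forallP H]]; left.
  rewrite -(sum_affine (zeros (slice v)) (mx2 u1 u)) -card_rV mulnC -sum_nat_const.
  rewrite -big_split mulnC -sum_nat_const; apply: leq_sum => y0 _ /=.
  apply: leq_trans (H y0); rewrite leq_add2r; apply: eq_leq; apply: eq_card => x.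
  by rewrite !inE /f !eval_asub.
right=> u u1 Du.
have [y0 Hy] : exists y0, ~~ (#|zeros (f u u1 y0)| + maxn 1 e.-1 <= e * q)%N.
  apply/existsP; apply: contraNT H => /existsPn H; apply/existsP; exists u.
  apply/existsP; exists u1; rewrite Du; apply/forallP => y0.
  by have := H y0; rewrite negbK.
have row01 : row2 0 1 *m mx2 u1 u = u by rewrite row2_mx2 scale0r add0r scale1r.
have [|||H1|[c Hc]] := @planar F (f u u1 y0) e e_gt0.
- by rewrite eS.
- by rewrite eS (leq_trans (msize_asub (D := e) _ _ _)) ?eS // msize_slice.
- by rewrite lpoly_asub row01 mul0mx addr0 coef_lpoly_of_slice.
- by rewrite H1 in Hy.
exists y0, c => t s; have := Hc t s; rewrite !eval_asub !row2_mx2 scale0r add0r.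
move=> <-; congr (ev (v + _ *m A)); rewrite -addrA; congr (_ + _).
by rewrite scalerDr scalerDl scalerA [c * t]mulrC -addrA; congr (_ + _); rewrite addrC.
Qed.

Section Extremal.
Variable v : 'rV[F]_k.
Hypotheses (nker : ~~ inker v) (extv : extremal v).
Let g (y : 'rV_l) := D (y *m A) v.

Let gZ c y : g (c *: y) = c ^+ e * g y.
Proof. by rewrite /g -scalemxAl (dirder_homog _ _ _ hp). Qed.

(** g of a direction is the coefficient of degree e of p along a line from [y0] in that direction,
    so the invariance of p on the plane passes to g. *)
Let g_plane u u1 : g u != 0 -> exists y0 c,
  (forall t s, ev (v + (y0 + t *: (u1 + c *: u) + s *: u) *m A) = ev (v + (y0 + s *: u) *m A))
  /\ forall t s, g (t *: (u1 + c *: u) + s *: u) = s ^+ e * g u.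
Proof.
move=> gu; have [y0 [c H]] := extv u1 gu; exists y0, c; split=> // t s.
rewrite -gZ /g -!(coef_lpoly_of_slice v y0).
suff -> : lpoly y0 (t *: (u1 + c *: u) + s *: u) (slice v) = lpoly y0 (s *: u)
  (slice v) by [].
have sz w : (size (lpoly y0 w (slice v)) <= q)%N.
  exact: leq_trans (size_lpoly_of_slice _ _ _) dq.
apply: poly_eq_fun => // r; rewrite !horner_lpoly !eval_slice.
by rewrite scalerDr !scalerA addrA H.
Qed.

Let pow_eq0 (c : F) : (c ^+ e == 0) = (c == 0).
Proof. by rewrite expf_eq0 e_gt0. Qed.

(** If g were nonzero at u = v1 + v2, then on the plane of u and v1 the zero v1 forces c = 0, and g
    would take the same value at v2 as at u. *)
Let gD v1 v2 : g v1 = 0 -> g v2 = 0 -> g (v1 + v2) = 0.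
Proof.
move=> g1 g2; apply/eqP; apply: contraT => gu.
have [y0 [c [_ H]]] := g_plane v1 gu.
have c0 : c = 0.
  have := H 1 (- c); rewrite scale1r scaleNr addrK g1 => /esym/eqP.
  by rewrite mulf_eq0 (negPf gu) orbF pow_eq0 oppr_eq0 => /eqP.
have := H (-1) 1; rewrite c0 scale0r addr0 scaleN1r scale1r addKr g2 expr1n mul1r.
by move/esym/eqP; rewrite (negPf gu).
Qed.

Lemma extremal_form : exists (u : 'rV_l) (a : 'cV_l),
  [/\ (u *m a) 0 0 = 1, D (u *m A) v != 0,
      forall y, D (y *m A) v = D (u *m A) v * (y *m a) 0 0 ^+ e
    & forall y, ev (v + y *m A) = ev (v + ((y *m a) 0 0 *: u) *m A)].
Proof.
have /forallPn[u gu] := nker; rewrite -/(g u) in gu.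
have g_shift y : exists c, g (y + c *: u) = 0.
  have [y0 [c [_ H]]] := g_plane y gu; exists c.
  by have := H 1 0; rewrite scale1r scale0r addr0 expr0n (gtn_eqF e_gt0) mul0r.
(* Shifting the basis vectors along [u] into the zero set of g yields the coefficients of the linear
   form [a], whose kernel is that zero set; [pr] is the projection onto it along [u]. *)
have [c cE] := fin_all_exists (fun i : 'I_l => g_shift (delta_mx 0 i)).
pose a : 'cV[F]_l := \col_i - c i; exists u, a.
pose pr (y : 'rV_l) := y - (y *m a) 0 0 *: u.
have g_pr y : g (pr y) = 0.
  have -> : pr y = \sum_i y 0 i *: (delta_mx 0 i + c i *: u).
    rewrite /pr {1}[y]row_sum_delta mxE scaler_suml -sumrB; apply: eq_bigr => i _.
    by rewrite scalerDr mxE mulrN scaleNr opprK scalerA.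
  apply: (big_ind (fun y => g y = 0)) => [||i _]; last by rewrite gZ cE mulr0.
    by rewrite -(scale0r u) gZ expr0n (gtn_eqF e_gt0) mul0r.
  exact: gD.
have ua : (u *m a) 0 0 = 1.
  have := g_pr u; rewrite /pr -{1}[u]scale1r -scalerBl gZ => /eqP.
  by rewrite mulf_eq0 (negPf gu) orbF pow_eq0 subr_eq0 => /eqP.
have planeK w : g w = 0 -> exists y0, (forall t s,
    ev (v + (y0 + t *: w + s *: u) *m A) = ev (v + (y0 + s *: u) *m A)) /\
    forall t s, g (t *: w + s *: u) = s ^+ e * g u.
  move=> gw; have [y0 [c' [H1 H2]]] := g_plane w gu; exists y0.
  suff c0 : c' = 0 by move: H1 H2; rewrite c0 scale0r addr0.
  have := H2 1 (- c'); rewrite scale1r scaleNr addrK gw => /esym/eqP.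
  by rewrite mulf_eq0 (negPf gu) orbF pow_eq0 oppr_eq0 => /eqP.
have prE y : y = pr y + (y *m a) 0 0 *: u by rewrite subrK.
split=> // y.
  have [y0 [_ H]] := planeK _ (g_pr y).
  by rewrite -!/(g _) {1}[y]prE -[pr y]scale1r H mulrC.
set s := (y *m a) 0 0.
pose P : 'M[F]_l := 1%:M - a *m u.
have PE x : x *m P = pr x.
  rewrite mulmxBr mulmx1 mulmxA /pr; congr (_ - _).
  by rewrite {1}[x *m a]mx11_scalar mul_scalar_mx.
(* [f] describes p on the affine hyperplane y a = s. It is constant on some line in each direction,
   hence constant by [const_lines]. *)
pose f := asub 0 P (slice (v + (s *: u) *m A)).
have fE x : eval_row f x = ev (v + (pr x + s *: u) *m A).
  by rewrite eval_asub add0r PE eval_slice -addrA -mulmxDl [_ + pr x]addrC.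
have fc := @const_lines F l f.
have szf : (msize f <= q)%N.
  apply: leq_trans dq; rewrite -eS; apply: msize_asub; rewrite eS; exact: msize_slice.
have := fc szf _ y 0; rewrite !fE -/s -prE.
have -> : pr 0 = 0 by rewrite /pr mul0mx mxE scale0r subr0.
rewrite add0r; apply=> w.
have [y0 [H _]] := planeK _ (g_pr w); exists y0 => t; rewrite !fE.
have -> : pr (y0 + t *: w) + s *: u = y0 + t *: pr w + (s - (y0 *m a) 0 0) *: u.
  rewrite -!PE mulmxDl -scalemxAl !PE {1}/pr scalerBl.
  by rewrite [y0 - _ + _]addrAC -!addrA [- _ + _]addrC.
rewrite H; congr (ev (v + _ *m A)).
by rewrite /pr scalerBl addrA addrAC.
Qed.

Lemma extremal_invariant (y w : 'rV_l) : D (w *m A) v = 0 ->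
  ev (v + (y + w) *m A) = ev (v + y *m A).
Proof.
have [u [a [ua gu gE evE]]] := extremal_form.
rewrite gE => /eqP; rewrite mulf_eq0 (negPf gu) pow_eq0 /= => /eqP wa.
by rewrite evE [RHS]evE mulmxDl mxE wa addr0.
Qed.

End Extremal.
End Slices.

(** * Counting points on slices *)

Lemma card_submx (F : finFieldType) m k (M : 'M[F]_(m, k)) :
  #|[set v : 'rV[F]_k | (v <= M)%MS]| = (#|F| ^ \rank M)%N.
Proof.
rewrite -card_rV -(card_imset _ (row_free_inj (row_base_free M))).
apply: eq_card => v; rewrite !inE -(eq_row_base M).
apply/submxP/imsetP => [[z ->]|[z _ ->]]; by exists z.
Qed.

Section Counting.
Variables (F : finFieldType) (k d l : nat) (p : {mpoly F[k]}) (A : 'M[F]_(l, k)).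
Local Notation q := #|F|.
Local Notation ev := (eval_row p).
Local Notation D := (dirder p).
Local Notation e := d.-1.
Hypotheses (hp : p \is d.-homog) (d2 : (2 <= d)%N) (dq : (d <= q)%N).
Hypothesis hL : forall y : 'rV_l, ev (y *m A) = 0.
Hypothesis freeA : row_free A.
Hypothesis hmax : forall v, ~~ (v <= A)%MS -> exists y : 'rV_l, ev (v + y *m A) != 0.

Let d_gt0 : (0 < d)%N. Proof. exact: ltnW. Qed.
Let e_gt0 : (0 < e)%N. Proof. by rewrite -ltnS prednK. Qed.
Let q_gt0 : (0 < q)%N. Proof. exact: leq_trans dq. Qed.

Definition Lset := [set v : 'rV[F]_k | (v <= A)%MS].
Definition Kset := [set v : 'rV[F]_k | inker p A v].
(* By extremal_dichotomy the slices outside Kset and Xset are extremal. *)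
Definition Xset := [set v in ~: Kset |
  q ^ 2 * #|zeros (slice p A v)| + maxn 1 e.-1 * q ^ l <= e * q * q ^ l]%N.

Lemma card_Lset : #|Lset| = (q ^ l)%N.
Proof. by rewrite card_submx (eqP freeA). Qed.

(** One column for each vector of L, so that the left kernel is [Kset], which is thus a linear
    subspace. *)
Definition gradients : 'M[F]_(k, #|{: 'rV[F]_l}|) :=
  \matrix_(i, j) eval_row p^`M(i) (enum_val j *m A).

Lemma inker_submx v : inker p A v = (v <= kermx gradients)%MS.
Proof.
apply/forallP/sub_kermxP => [H|/rowP H u].
  apply/rowP=> j; rewrite mxE [RHS]mxE; apply: etrans (eqP (H (enum_val j))).
  by apply: eq_bigr => i _; rewrite mxE.
have := H (enum_rank u); rewrite mxE [RHS]mxE => E; apply/eqP; apply: etrans E.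
by apply: eq_bigr => i _; rewrite mxE enum_rankK.
Qed.

Definition kdim := \rank (kermx gradients).

Lemma card_Kset : #|Kset| = (q ^ kdim)%N.
Proof. by rewrite -card_submx; apply: eq_card => v; rewrite !inE inker_submx. Qed.

Lemma subset_LK : Lset \subset Kset.
Proof.
apply/subsetP=> v; rewrite !inE => /submxP[y ->]; apply/forallP=> u.
by rewrite (dirder_slice hp d2 dq hL).
Qed.

(* A form c (y a)^e is rewritten as b_i (y b / b_i)^e for the first nonzero entry
   b_i of a vector b, so that there are at most q^l - 1 such forms. *)
Definition form_of (b : 'cV[F]_l) (y : 'rV[F]_l) : F :=
  if [pick i | b i 0 != 0] is Some i then b i 0 * ((y *m b) 0 0 / b i 0) ^+ e else 0.

Lemma extremal_form_of v : v \notin Kset -> v \notin Xset ->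
  exists2 b, b != 0 & forall y, D (y *m A) v = form_of b y.
Proof.
rewrite !inE => nk; rewrite nk /= => nx.
have extv : extremal p A v.
  by case: (extremal_dichotomy hp d2 dq hL v) => // H; rewrite H in nx.
have [u [a [ua Du gE _]]] := extremal_form hp d2 dq hL nk extv.
have [i ai] : exists i, a i 0 != 0.
  apply/existsP; apply: contraT => /existsPn H; move: ua.
  have -> : a = 0 by apply/colP=> i; have := H i; rewrite negbK mxE => /eqP.
  by rewrite mulmx0 mxE => /esym/eqP; rewrite oner_eq0.
have [j aj pickE] : exists2 j, a j 0 != 0 & [pick i | a i 0 != 0] = Some j.
  by case: pickP => [j aj|H]; [exists j|rewrite H in ai].
(* The solution of kap a_j (y a / a_j)^e = D(u A)(v) (y a)^e, where j is the index picked by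
   [form_of]. *)
pose kap := D (u *m A) v * a j 0 ^+ e / a j 0.
have kap0 : kap != 0 by rewrite !mulf_neq0 ?invr_neq0 ?expf_neq0.
exists (kap *: a).
  by rewrite scaler_eq0 (negPf kap0) /=; apply: contraNneq aj => ->; rewrite mxE.
move=> y; rewrite gE /form_of.
have -> : [pick i | (kap *: a) i 0 != 0] = [pick i | a i 0 != 0].
  by apply: eq_pick => i'; rewrite /= mxE mulf_eq0 (negPf kap0).
rewrite pickE; have -> : (kap *: a) j 0 = kap * a j 0 by rewrite mxE.
have -> : (y *m (kap *: a)) 0 0 = kap * (y *m a) 0 0 by rewrite -scalemxAr mxE.
rewrite invfM mulrACA divff // mul1r /kap divfK // expr_div_n -!mulrA; congr (_ * _).
by rewrite [RHS]mulrC divfK // expf_neq0.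
Qed.

(** G_v is linear in v, so the vectors with a given G_v differ by elements of [Kset]. *)
Lemma card_form_of b : (#|[set v | [forall y, D (y *m A) v == form_of b y]]| <= #|Kset|)%N.
Proof.
set S := [set v | _]; have [->|[v0 v0S]] := set_0Vmem S; first by rewrite cards0.
rewrite -(card_imset S (addIr (- v0))); apply: subset_leq_card;
  apply/subsetP=> _ /imsetP[v vS ->].
rewrite inE; apply/forallP=> y; move: v0S vS;
  rewrite !inE => /forallP/(_ y)/eqP E0 /forallP/(_ y)/eqP E.
by rewrite dirderD -scaleN1r dirderZ E0 E mulN1r subrr.
Qed.

Lemma card_extremal : (#|~: (Kset :|: Xset)| <= (q ^ l - 1) * #|Kset|)%N.
Proof.
pose S b := [set v | [forall y, D (y *m A) v == form_of b y]].
have <- : #|predC1 (0 : 'cV[F]_l)| = (q ^ l - 1)%N by rewrite cardC1 card_mx muln1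
  subn1.
rewrite -sum_nat_const.
pose T := (\sum_(v in ~: (Kset :|: Xset)) \sum_(b in predC1 (0%R : 'cV[F]_l)) (v \in S b))%N.
apply: (@leq_trans T); rewrite /T.
  rewrite -sum1_card; apply: leq_sum => v; rewrite !inE negb_or => /andP[nK nX].
  have [||b b0 bE] := @extremal_form_of v; rewrite ?inE //.
  rewrite (bigD1 b) //= inE; have -> : [forall y, D (y *m A) v == form_of b y].
    by apply/forallP=> y; rewrite bE.
  by rewrite leq_addr.
rewrite exchange_big /=; apply: leq_sum => b _; apply: leq_trans (card_form_of b).
rewrite -sum1_card [X in (_ <= X)%N]big_mkcond [X in (X <= _)%N]big_mkcond /=.
by apply: leq_sum => v _; rewrite /S; case: ifP; case: (v \in _).
Qed.

Lemma card_nonextremal : (q ^ k <= #|Xset| + q ^ l * #|Kset|)%N.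
Proof.
have := cardsC (Kset :|: Xset); rewrite card_rV => <-.
have -> : #|Kset :|: Xset| = (#|Kset| + #|Xset|)%N.
  rewrite -[RHS](cardsUI Kset Xset); have -> : Kset :&: Xset = set0.
    by apply/setP=> v; rewrite !inE; case: (inker _ _ _).
  by rewrite cards0 addn0.
have := card_extremal; have : (0 < q ^ l)%N by rewrite expn_gt0 q_gt0.
by move: (q ^ l)%N (#|Kset|) (#|Xset|) => a b c; nia.
Qed.

Lemma slice_neq0 v : v \notin Lset -> slice p A v != 0.
Proof.
rewrite inE => /hmax[y]; apply: contraNneq => s0.
by rewrite -(eval_slice p A) s0 eval_row0.
Qed.

Lemma sum_zeros : (\sum_v #|zeros (slice p A v)| = q ^ l * #|zeros p|)%N.
Proof.
rewrite -(sum_affine _ A); apply: eq_bigr => v _; apply: eq_card => y.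
by rewrite !inE eval_slice.
Qed.

Lemma zeros_Lset v : v \in Lset -> #|zeros (slice p A v)| = (q ^ l)%N.
Proof.
rewrite inE => /submxP[y ->]; rewrite -card_rV; apply: eq_card => x.
by rewrite !inE eval_slice -mulmxDl hL eqxx.
Qed.

(** Sum of the bounds for single slices over all v, by the position of v with respect to L, [Kset]
    and [Xset]. Savings are added on the left to avoid subtraction; a factor q^l is cancelled at the
    end. *)
Lemma main_count :
  (q ^ 2 * #|zeros p| + maxn 1 e.-1 * #|Xset| + e.-1 * q * q ^ l + e * q * #|Kset| <=
   q ^ 2 * q ^ l + e.-1 * q * #|Kset| + e * q * q ^ k)%N.
Proof.
have ql : (0 < q ^ l)%N by rewrite expn_gt0 q_gt0.
pose f v := (q ^ 2 * #|zeros (slice p A v)| + (v \in Xset) * (maxn 1 e.-1 * q ^ l) +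
  (v \in Lset) * (e.-1 * q * q ^ l) + (v \in Kset) * (e * q * q ^ l))%N.
pose g v := ((v \in Lset) * (q ^ 2 * q ^ l) + (v \in Kset) * (e.-1 * q * q ^ l) + e * q * q ^ l)%N.
have fg v : (f v <= g v)%N.
  rewrite /f /g; case: (boolP (v \in Lset)) => [vL|nL].
    have vK := subsetP subset_LK _ vL; rewrite vK zeros_Lset //.
    have -> : (v \in Xset) = false by move: vK; rewrite !inE => ->.
    by rewrite !mul1n mul0n addn0; apply: eq_leq; ring.
  case: (boolP (v \in Kset)) => [vK|nK].
    have -> : (v \in Xset) = false by move: vK; rewrite !inE => ->.
    have : inker p A v by rewrite inE in vK.
    move/(zeros_ker hp d2 dq hL)/(_ (slice_neq0 nL)).
    rewrite expnS expn1 !mul0n !mul1n !addn0 !add0n leq_add2r -!mulnA => H.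
    by rewrite [(e.-1 * _)%N]mulnCA leq_mul2l H orbT.
  case: (boolP (v \in Xset)) => [vX|nX].
    by move: (vX); rewrite !inE => /andP[_]; rewrite !mul0n !mul1n !addn0 !add0n.
  have : ~~ inker p A v by rewrite inE in nK.
  move/(zeros_noker hp d2 dq hL).
  rewrite expnS expn1 !mul0n !addn0 !add0n -!mulnA => H.
  by rewrite [(e * _)%N]mulnCA leq_mul2l H orbT.
have card_sum (S : {set 'rV[F]_k}) c : (\sum_v (v \in S) * c = #|S| * c)%N.
  by rewrite -big_distrl /= -sum1_card [in RHS]big_mkcond; congr (_ * _)%N;
    apply: eq_bigr => v _; case: (_ \in _).
have : (\sum_v f v <= \sum_v g v)%N by apply: leq_sum.
rewrite /f /g !big_split /= -big_distrr /= sum_zeros !card_sum sum_nat_const card_rV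
  card_Lset.
move=> H; rewrite -(leq_pmul2l ql); move: (q ^ l)%N H => Q H.
by apply: leq_trans (leq_trans _ H) _; apply: eq_leq; ring.
Qed.

End Counting.

(** * Hypersurfaces with at least theta points *)

(** Inserting the lower bound for [N] in the main count gives [star]. If [kap + l <= 2 * h], the
    other count makes [X] too large, as q^3 q^h <= q^(2h) for h > 2. Otherwise [l < h] or
    [kap > h + 1] makes q q^kap at least q^3 q^h, which is again too large. *)
Lemma extremal_dims (q e l h kap N X : nat) :
  (0 < e)%N -> (e < q)%N -> (2 < h)%N -> (l <= h)%N ->
  (e * q ^ (2 * h) + q ^ h <= N + e * q ^ h)%N ->
  (q ^ (2 * h).+1 <= X + q ^ l * q ^ kap)%N ->
  (q ^ 2 * N + maxn 1 e.-1 * X + e.-1 * q * q ^ l + e * q * q ^ kap <=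
   q ^ 2 * q ^ l + e.-1 * q * q ^ kap + e * q * q ^ (2 * h).+1)%N ->
  [/\ l = h, kap = h.+1 & (X + q ^ h.+1 <= q ^ h.+2)%N].
Proof.
move=> e0 eq h2 lh NT Xb main.
have q1 : (1 < q)%N by apply: leq_ltn_trans eq.
have q0 : (0 < q)%N by apply: ltnW.
have Hh0 : (0 < q ^ h)%N by rewrite expn_gt0 q0.
have star : (maxn 1 e.-1 * X + e.-1 * q * q ^ l + q * q ^ kap + q ^ 2 * q ^ h <=
   q ^ 2 * q ^ l + e * q ^ 2 * q ^ h)%N.
  move: main NT; rewrite (expnS q (2 * h)) -[e in (e * q * q ^ kap)%N](prednK e0).
  move: (q ^ (2 * h))%N (q ^ kap)%N (q ^ l)%N (q ^ h)%N (maxn 1 e.-1 * X)%N => H2 K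
    L H M.
  move=> main NT; have : (q ^ 2 * (e * H2 + H) <= q ^ 2 * (N + e * H))%N by rewrite
    leq_mul2l NT orbT.
  nia.
have g1 : (X <= maxn 1 e.-1 * X)%N by rewrite leq_pmull // leq_max.
have Llh : (q ^ l <= q ^ h)%N by rewrite leq_pexp2l.
have eH : (e * q ^ 2 * q ^ h + q ^ 2 * q ^ h <= q ^ 3 * q ^ h)%N.
  rewrite -mulnDl leq_mul2r; apply/orP; right;
    rewrite -mulSnr [(q ^ 3)%N]expnS leq_mul2r.
  by rewrite eq orbT.
have H2 : (q ^ 3 * q ^ h <= q ^ (2 * h))%N.
  by rewrite -expnD leq_pexp2l //; lia.
case: (leqP (kap + l) (2 * h)) => kl.
  have KL : (q ^ l * q ^ kap <= q ^ (2 * h))%N by rewrite -expnD leq_pexp2l // addnC.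
  have Xb' : (q * q ^ (2 * h) <= X + q ^ (2 * h))%N by rewrite -expnS (leq_trans Xb)
    // leq_add2l.
  have p2 : (0 < q ^ 2 * q ^ h)%N by rewrite muln_gt0 expn_gt0 q0.
  have e3 : (q ^ 3 * q ^ h = q * (q ^ 2 * q ^ h))%N by rewrite mulnA -expnS.
  have L2 : (q ^ 2 * q ^ l <= q ^ 2 * q ^ h)%N by rewrite leq_mul2l Llh orbT.
  have low : (q.-1 * (q * (q ^ 2 * q ^ h)) <= X)%N.
    rewrite -e3; apply: (@leq_trans (q.-1 * q ^ (2 * h)));
      first by rewrite leq_mul2l H2 orbT.
    by rewrite -(leq_add2r (q ^ (2 * h))) -mulSnr prednK.
  have up : (X + q ^ 2 * q ^ h <= q * (q ^ 2 * q ^ h))%N.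
    rewrite -e3; move: star eH g1 L2; clear.
    move: (q ^ 2 * q ^ h)%N (q ^ 2 * q ^ l)%N (q * q ^ kap)%N (e.-1 * q * q ^ l)%N.
    move: (e * q ^ 2 * q ^ h)%N (q ^ 3 * q ^ h)%N (maxn _ _ * X)%N => *; lia.
  exfalso; move: low up p2 q1; clear; move: (q ^ 2 * q ^ h)%N => H.
  by case: q => [|[|q]] //=; nia.
have Kb : (l < h)%N || (h.+1 < kap)%N -> (q ^ 3 * q ^ h <= q * q ^ kap)%N.
  by move=> hk; rewrite -expnD -expnS leq_pexp2l //; lia.
have Lb : (l < h)%N -> (q ^ 2 * q ^ l <= q * q ^ h)%N.
  by move=> hk; rewrite -expnD -expnS leq_pexp2l //; lia.
have qH : (q * q ^ h < q ^ 2 * q ^ h)%N by rewrite ltn_mul2r Hh0 expnS expn1 ltn_Pmull.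
case: (leqP h l) => hl; last first.
  have := Kb _; rewrite hl => /(_ isT) K3; have := Lb hl => L1.
  by exfalso; move: K3 L1 qH star eH; lia.
have lE : l = h by apply/eqP; rewrite eqn_leq lh.
rewrite lE in star kl *.
case: (leqP kap h.+1) => hk; last first.
  have := Kb _; rewrite hk orbT => /(_ isT) K3.
  have : (0 < q ^ 2 * q ^ h)%N by rewrite muln_gt0 expn_gt0 q0.
  by exfalso; move: K3 star eH; lia.
have kE : kap = h.+1 by lia.
split=> //; move: star; rewrite kE !expnS expn0 muln1 !mulnA.
(* What remains of [star] is max(1, e - 1) X + (e - 1) q H <= (e - 1) q^2 H. For e = 1 it gives X =
   0; otherwise e - 1 cancels. *)
move: (q ^ h)%N => H; case: (e) e0 => // [[|e']] _ /=.
  move=> star; have -> : X = 0%N by move: star; clear; rewrite mul1n maxnE /=; lia.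
  by rewrite add0n leq_mul2r leq_pmulr ?orbT.
rewrite (maxn_idPr _) // => star.
have : (e'.+1 * (X + q * H) <= e'.+1 * (q * q * H))%N by move: star; clear; nia.
by rewrite leq_pmul2l.
Qed.

Section Conclusion.
Variables (F : finFieldType) (k h d l : nat) (p : {mpoly F[k]}) (A : 'M[F]_(l, k)).
Local Notation q := #|F|.
Local Notation ev := (eval_row p).
Local Notation D := (dirder p).
Local Notation e := d.-1.
Hypotheses (hk : k = (2 * h).+1).
Hypotheses (hp : p \is d.-homog) (d2 : (2 <= d)%N) (dq : (d <= q)%N) (h3 : (2 < h)%N).
Hypothesis hL : forall y : 'rV_l, ev (y *m A) = 0.
Hypothesis freeA : row_free A.
Hypothesis hmax : forall v, ~~ (v <= A)%MS -> exists y : 'rV_l, ev (v + y *m A) != 0.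
Hypothesis lh : (l <= h)%N.
Hypothesis smooth : forall u, u != 0 -> ev u = 0 -> exists i, eval_row p^`M(i) u != 0.
Hypothesis many : (e * q ^ (2 * h) + q ^ h <= #|zeros p| + e * q ^ h)%N.

Let d_gt0 : (0 < d)%N. Proof. exact: ltnW. Qed.
Let e_gt0 : (0 < e)%N. Proof. by rewrite -ltnS prednK. Qed.
Let e_lt : (e < q)%N. Proof. by rewrite prednK. Qed.
Let q_gt0 : (0 < q)%N. Proof. exact: leq_trans dq. Qed.

Lemma many_dims : [/\ l = h, kdim p A = h.+1 & (#|Xset d p A| + q ^ h.+1 <= q ^ h.+2)%N].
Proof.
apply: (@extremal_dims q e l h (kdim p A) #|zeros p|) => //; rewrite -card_Kset.
  by rewrite -hk; apply: card_nonextremal.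
by rewrite -hk; apply: main_count.
Qed.

Lemma card_L : #|Lset A| = (q ^ h)%N.
Proof. by have [lE _ _] := many_dims; rewrite card_Lset //; congr (q ^ _)%N. Qed.

Lemma card_K : #|Kset p A| = (q ^ h.+1)%N.
Proof. by have [_ kE _] := many_dims; rewrite card_Kset kE. Qed.

Lemma pow_k : (q ^ k = q ^ (2 * h).+1)%N.
Proof. by rewrite hk. Qed.

Lemma pow_l : (q ^ l = q ^ h)%N.
Proof. by have [lE _ _] := many_dims; congr (q ^ _)%N. Qed.

Local Notation tangent := (tangent_space p).

Lemma tangentP u v : (v <= tangent u)%MS = (D u v == 0).
Proof.
apply/sub_kermxP/eqP => [/matrixP/(_ 0 0)|H].
  by rewrite !mxE => E; apply: etrans E; apply: eq_bigr => i _; rewrite mxE.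
apply/matrixP => i j; rewrite !ord1 !mxE; apply: etrans H.
by apply: eq_bigr => i' _; rewrite mxE.
Qed.

Lemma rank_tangent u : u != 0 -> ev u = 0 -> \rank (tangent u) = (2 * h)%N.
Proof.
move=> u0 evu; rewrite /tangent_space mxrank_ker; have [i Hi] := smooth u0 evu.
suff -> : \rank (\col_i eval_row p^`M(i) u) = 1%N by rewrite subn1 hk.
apply/eqP; rewrite eqn_leq rank_leq_col /= lt0n mxrank_eq0.
by apply: contraNneq Hi => /colP/(_ i); rewrite !mxE => ->.
Qed.

(* p(v + u) - p(v), with u = w *m A, has degree < d in v and vanishes at all but
   few points of the tangent space at u. *)
Lemma cone_translate (w : 'rV_l) v : D (w *m A) v = 0 -> ev (v + w *m A) = ev v.
Proof.
have [w0|w0] := eqVneq (w *m A) 0; first by rewrite w0 addr0.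
move=> Dv; have [lE kE Xle] := many_dims.
set u := w *m A in w0 Dv *; pose T := tangent u.
pose B := row_base T; pose f := asub u B p - asub 0 B p.
have fE y : eval_row f y = ev (y *m B + u) - ev (y *m B).
  by rewrite eval_rowD -scaleN1r eval_rowZ mulN1r !eval_asub add0r [u + _]addrC.
have evB (v' : 'rV_k) : (v' <= T)%MS -> exists y, v' = y *m B.
  by rewrite -(eq_row_base T) => /submxP.
suff f0 : f = 0.
  have [|y ->] := evB v; first by rewrite tangentP Dv.
  by apply/eqP; rewrite -subr_eq0 -fE f0 eval_row0.
apply/eqP; apply: contraT => f0.
have szp : (msize p <= d.+1)%N by apply: msize_homog.
have szf : (msize f <= d.+1)%N.
  by apply: (leq_trans (msizeD_le _ _)); rewrite geq_max msizeN !msize_asub.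
(* Both terms of [f] have the same part of degree d, which cancels. *)
have lines y w' : (size (lpoly y w' f) <= e.+1)%N.
  rewrite prednK //; apply/leq_sizeP => j; rewrite leq_eqVlt => /orP[/eqP <-|lt].
    rewrite lpolyD -scaleN1r lpolyZ coefD coefZ !lpoly_asub !(coef_lpoly_homog _ _ hp).
    by rewrite mulN1r subrr.
  by rewrite nth_default // (leq_trans (size_lpoly _ _ szf)).
have szfq : (msize f <= q.+1)%N by apply: leq_trans szf _; rewrite ltnS.
have := zeros_bound szfq lines f0.
have rT : \rank T = (2 * h)%N by rewrite rank_tangent // /u hL.
have rTq : (q ^ \rank T = q ^ (2 * h))%N by rewrite rT.
rewrite rTq.
(* The vectors to which neither [extremal_invariant] nor membership in L applies. *)
pose Bad := Xset d p A :|: (Kset p A :\: Lset A).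
have cardBad : (#|Bad| + q ^ h <= q ^ h.+2)%N.
  have := cardsUI (Xset d p A) (Kset p A :\: Lset A).
  have := cardsID (Lset A) (Kset p A).
  have -> : Kset p A :&: Lset A = Lset A.
    by apply/setIidPr; apply: (subset_LK hp).
  rewrite card_K card_L -/Bad.
  by move: Xle; move: #|Bad| #|Xset d p A| #|_ :\: _| #|_ :&: _| => a b c d'; lia.
have cardz : (q ^ (2 * h) <= #|zeros f| + #|Bad|)%N.
  rewrite -rTq -card_rV -(cardsC (zeros f)) leq_add2l.
  rewrite -(card_imset _ (row_free_inj (row_base_free T))).
  apply: subset_leq_card; apply/subsetP => _ /imsetP[y yz ->].
  apply: contraLR yz => nBad; rewrite !inE negbK fE subr_eq0.
  have yT : D u (y *m B) = 0.
    by apply/eqP; rewrite -tangentP; apply: submx_trans (submxMl _ _) _;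
      rewrite eq_row_base.
  case: (boolP (y *m B \in Lset A)) => [|nL].
    by rewrite inE => /submxP[z ->]; rewrite -mulmxDl !hL.
  move: nBad; rewrite in_setU negb_or in_setD nL /= => /andP[nX nK].
  have extv : extremal p A (y *m B).
    case: (extremal_dichotomy hp d2 dq hL (y *m B)) => // H.
    by move: nX; rewrite inE in_setC nK H.
  have nker : ~~ inker p A (y *m B) by move: nK; rewrite inE.
  have := extremal_invariant hp d2 dq hL nker extv 0 yT.
  by rewrite add0r mul0mx addr0 => ->.
have q1 : (1 < q)%N by apply: leq_ltn_trans e_lt.
have H2 : (q ^ 3 * q ^ h <= q ^ (2 * h))%N.
  by rewrite -expnD leq_pexp2l //; lia.
have H0 : (0 < q ^ h)%N by rewrite expn_gt0 q_gt0.
(* A nonzero [f] has at most q^(2h) - q^(2h-1) zeros, since e < q, but it has at least q^(2h) -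
   q^(h+2) + q^h; this is absurd because h + 2 <= 2h - 1. *)
move=> zb; move: zb cardz cardBad H2 H0; rewrite !expnS expn0 muln1.
move: #|zeros f| #|Bad| (q ^ h)%N (q ^ (2 * h))%N e_lt => z b H HH; nia.
Qed.

(** By [cone_translate], p is constant on v + L, and the constant is nonzero by maximality of L. *)
Lemma zeros_K v : v \in Kset p A -> v \notin Lset A -> #|zeros (slice p A v)| = 0%N.
Proof.
rewrite inE => /forallP vK vL; apply/eqP; rewrite cards_eq0; apply/eqP/setP=> y.
rewrite !inE eval_slice; apply/negbTE.
rewrite cone_translate; last exact/eqP.
move: vL; rewrite inE => /hmax[y']; rewrite cone_translate //; exact/eqP.
Qed.

(** Allowing any [S] above [Kset] serves twice: the whole space gives the upper bound, and the
    complement of one vector isolates its slice. *)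
Lemma sum_slices (S : {set 'rV[F]_k}) : Kset p A \subset S ->
  (\sum_(v in S) q * #|zeros (slice p A v)| <=
   q * q ^ h * q ^ h + #|S :\: Kset p A| * (e * q ^ h))%N.
Proof.
have [lE kE Xle] := many_dims.
move=> KS; rewrite (big_setID (Kset p A)) /= (setIidPr KS); apply: leq_add.
  rewrite (big_setID (Lset A)) /= (setIidPr (subset_LK hp d2 dq hL)).
  rewrite [X in (_ + X <= _)%N]big1 ?addn0 => [|v]; last first.
    by rewrite inE => /andP[vL vK]; rewrite zeros_K // muln0.
  rewrite (eq_bigr (fun=> q * q ^ h)%N) => [|v vL]; last by rewrite zeros_Lset // pow_l.
  by rewrite sum_nat_const card_L mulnC.
rewrite -sum_nat_const; apply: leq_sum => v; rewrite inE => /andP[vK _].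
by rewrite -pow_l; apply: zeros_noker => //; rewrite inE in vK.
Qed.

Lemma zeros_le : (#|zeros p| + e * q ^ h <= e * q ^ (2 * h) + q ^ h)%N.
Proof.
have [lE kE Xle] := many_dims.
have := sum_slices (subsetT _); rewrite (eq_bigl xpredT) => [|v]; last by rewrite inE.
rewrite -big_distrr /= sum_zeros pow_l.
have := cardsID (Kset p A) setT; rewrite setTI cardsT card_rV card_K pow_k.
have Q0 : (0 < q ^ h)%N by rewrite expn_gt0 q_gt0.
rewrite !expnS => E H; have Qq : (0 < q * q ^ h)%N by rewrite muln_gt0 q_gt0.
rewrite -(leq_pmul2l Qq); move: E H Q0; rewrite setTD.
move: #|zeros p| #|~: _| (q ^ h)%N (q ^ (2 * h))%N => N M Q Q2 E H Q0.
have : ((q * Q + M) * (e * Q) = q * Q2 * (e * Q))%N by rewrite E.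
by move: H; clear; move: d.-1 #|F| => e q; nia.
Qed.

Hypothesis maximal : (#|zeros p| + e * q ^ h = e * q ^ (2 * h) + q ^ h)%N.

(** Equality in the total leaves no room: bounding all slices other than that of [v] gives the
    reverse inequality for [v]. *)
Lemma zeros_noK v : v \notin Kset p A -> (q * #|zeros (slice p A v)| = e * q ^ h)%N.
Proof.
have [lE kE Xle] := many_dims.
move=> vK; apply/eqP; rewrite eqn_leq; apply/andP; split.
  by rewrite -pow_l; apply: zeros_noker => //; rewrite inE in vK.
have H0 : Kset p A \subset [set~ v].
  by apply/subsetP=> x xK; rewrite !inE; apply: contraNneq vK => <-.
have tot : (\sum_v' q * #|zeros (slice p A v')| = q * q ^ h * #|zeros p|)%N.
  by rewrite -big_distrr /= sum_zeros pow_l mulnA.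
have : (q * q ^ h * #|zeros p| <= q * #|zeros (slice p A v)| +
    (q * q ^ h * q ^ h + #|[set~ v] :\: Kset p A| * (e * q ^ h)))%N.
  rewrite -tot (bigD1 v) //= leq_add2l (leq_trans _ (sum_slices H0)) //.
  by apply: eq_leq; apply: eq_bigl => x; rewrite !inE.
have := cardsC (Kset p A); rewrite card_rV card_K pow_k (cardsD1 v (~: _)) inE vK.
have -> : ~: Kset p A :\ v = [set~ v] :\: Kset p A.
  by apply/setP=> x; rewrite !inE andbC.
have Q0 : (0 < q ^ h)%N by rewrite expn_gt0 q_gt0.
move: maximal; rewrite !expnS /=.
move: #|zeros p| #|zeros (slice p A v)| #|_ :\: _| (q ^ h)%N (q ^ (2 * h))%N Q0.
move=> N Z M Q Q2 Q0 E1 E2 E3.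
have : (q * Q * (N + e * Q) = q * Q * (e * Q2 + Q))%N by rewrite E1.
have : ((q * Q + (1 + M)) * (e * Q) = q * Q2 * (e * Q))%N by rewrite E2.
by move: E3; clear; move: d.-1 #|F| => e q; nia.
Qed.

(** The tangent space is a union of cosets of L and contains [Kset], and in the case of equality the
    number of zeros of every slice is known. *)
Lemma card_tangent_zeros (w : 'rV_l) : w != 0 ->
  (q * #|zeros p :&: [set v | (v <= tangent_space p (w *m A))%MS]| + e * q * q ^ h =
   q * q ^ h + e * q ^ (2 * h))%N.
Proof.
have [lE kE Xle] := many_dims.
move=> w0; set u := w *m A; set T := [set v | _].
have u0 : u != 0.
  by apply: contraNneq w0 => /eqP; rewrite -(mul0mx _ A) (inj_eq (row_free_inj freeA)).
have KT : Kset p A \subset T.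
  by apply/subsetP=> v; rewrite !inE tangentP => /forallP; apply.
have LT : Lset A \subset T := subset_trans (subset_LK hp d2 dq hL) KT.
have cardT : #|T| = (q ^ (2 * h))%N by rewrite card_submx rank_tangent // /u hL.
have stT (v : 'rV_k) (y : 'rV_l) : ((v + y *m A)%R <= tangent u)%MS =
  (v <= tangent u)%MS.
  rewrite !tangentP dirderD (_ : D u (y *m A) = 0) ?addr0 //.
  exact: (dirder_slice hp d2 dq hL).
have : (\sum_(v in T) #|zeros (slice p A v)| = q ^ h * #|zeros p :&: T|)%N.
  rewrite -pow_l -(sum_affine _ A) big_mkcond; apply: eq_bigr => v _.
  case: ifP; rewrite inE => vT.
    by apply: eq_card => y; rewrite !inE stT vT andbT eval_slice.
  by rewrite eq_card0 // => y; rewrite !inE stT vT andbF.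
rewrite (big_setID (Kset p A)) /= (setIidPr KT) (big_setID (Lset A)) /=.
rewrite (setIidPr (subset_LK hp d2 dq hL)).
rewrite [X in (_ + X + _)%N]big1 => [|v]; last first.
  by rewrite inE => /andP[vL vK]; rewrite zeros_K.
rewrite (eq_bigr (fun=> q ^ h)%N) => [|v vL]; last by rewrite zeros_Lset // pow_l.
rewrite sum_nat_const card_L addn0 => E.
have : (q * \sum_(v in T :\: Kset p A) #|zeros (slice p A v)| = #|T :\: Kset p A| * (e * q ^ h))%N.
  rewrite big_distrr /= -sum_nat_const; apply: eq_bigr => v; rewrite inE => /andP[vK _].
  exact: zeros_noK.
have := cardsID (Kset p A) T; rewrite (setIidPr KT) cardT card_K.
have Q0 : (0 < q ^ h)%N by rewrite expn_gt0 q_gt0.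
move: E Q0; rewrite !expnS.
move: (\sum_(_ in _) _)%N #|_ :&: _| #|_ :\: _| (q ^ h)%N (q ^ (2 * h))%N.
move=> S N M Q Q2 E Q0 E2 E3.
have : (Q * (q * N + e * q * Q) = Q * (q * Q + e * Q2))%N by nia.
by move/eqP; rewrite eqn_pmul2l // => /eqP.
Qed.

End Conclusion.

(** * Projective points and nonsingularity *)

Section Points.
Variable F : finFieldType.
Local Notation q := #|F|.

Lemma card_nonzero : #|[set c : F | c != 0]| = q.-1.
Proof. by rewrite -(cardC1 (0 : F)); apply: eq_card => c; rewrite !inE. Qed.

(** Each point is represented by the q - 1 nonzero multiples of one vector. *)
Lemma Nq_count k (S : seq {mpoly F[k]}) :
  (forall p, p \in S -> exists d, p \is d.-homog) ->
  (q.-1 * Nq S = #|[set v : 'rV[F]_k | (v != 0%R) && all (fun p => eval_row p v == 0%R) S]|)%N.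
Proof.
move=> homS; set V := [set v | _].
have scV c v : c != 0 -> v \in V -> c *: v \in V.
  move=> c0; rewrite !inE scaler_eq0 negb_or c0 => /andP[-> /allP H] /=.
  apply/allP=> p pS; have [d hp] := homS p pS.
  by rewrite (eval_homogZ _ _ hp) (eqP (H p pS)) mulr0.
have -> : Nq S = #|[set line v | v in V]|.
  by rewrite /Nq; apply: eq_card => L; apply/imsetP/imsetP => -[v vV ->];
    exists v => //; move: vV; rewrite ?inE.
rewrite -[RHS]sum1_card (partition_big_imset (@line F k)) /= mulnC -sum_nat_const.
apply: eq_bigr => _ /imsetP[v vV ->]; rewrite sum1dep_card -card_nonzero.
have v0 : v != 0 by move: vV; rewrite inE => /andP[].
have inj : injective (fun c : F => c *: v).
  move=> a b /eqP; rewrite -subr_eq0 -scalerBl scaler_eq0 (negPf v0) orbF subr_eq0.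
  by move/eqP.
rewrite -(card_imset _ inj); apply: eq_card => w; rewrite [RHS]inE.
apply/imsetP/andP => [[c]|[wV /eqP E]].
  rewrite inE => c0 ->; split; first exact: scV.
  apply/eqP/setP=> x; apply/imsetP/imsetP => -[a _ ->].
    by exists (a * c); rewrite ?scalerA.
  by exists (a / c); rewrite // scalerA divfK.
have : w \in line v by rewrite -E; apply/imsetP; exists 1; rewrite ?scale1r.
case/imsetP=> c _ wE; exists c => //; rewrite inE; apply: contraTneq wV => c0.
by rewrite wE c0 scale0r inE eqxx.
Qed.

Lemma Nq_zeros k d (p : {mpoly F[k]}) : (0 < d)%N -> p \is d.-homog ->
  (q.-1 * Nq [:: p] + 1 = #|zeros p|)%N.
Proof.
move=> d0 hp; rewrite Nq_count => [|p']; last by rewrite inE => /eqP ->; exists d.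
have z0 : 0 \in zeros p.
  by rewrite inE -(scale0r (0 : 'rV[F]_k)) (eval_homogZ _ _ hp) expr0n gtn_eqF // mul0r.
rewrite (cardsD1 0 (zeros p)) z0 addnC; congr (_ + _)%N; apply: eq_card => v.
by rewrite !inE /= andbT.
Qed.

Lemma Nq_proj_count N : (q.-1 * Nq_proj F N + 1 = q ^ N.+1)%N.
Proof.
rewrite Nq_count // -(card_rV F N.+1) -cardsT [RHS](cardsD1 0) in_setT addn1 add1n;
  congr _.+1.
by apply: eq_card => v; rewrite !inE /= !andbT.
Qed.

(** The affine count (q - 1) theta + 1 is e q^(2h) - e q^h + q^h with e = d - 1; the negative term
    is moved to the left, as in the affine counts above. *)
Lemma theta_count d h : (0 < d)%N -> (0 < h)%N ->
  (q.-1 * theta F d (h.*2.-1) + 1 + d.-1 * q ^ h = d.-1 * q ^ (2 * h) + q ^ h)%N.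
Proof.
move=> d0 h0; rewrite /theta.
have -> : (h.*2.-1.+1)./2 = h by rewrite prednK ?doubleK // double_gt0.
have -> : (h.*2.-1.-1)./2 = h.-1 by case: (h) h0 => // h' _; rewrite doubleS /= doubleK.
have := Nq_proj_count h.-1; rewrite (prednK h0) mul2n -addnn expnD.
by move: (q.-1) (Nq_proj _ _) (d.-1) (q ^ h)%N => a b c x <-; ring.
Qed.

End Points.

Lemma row_free_col_rV (K : fieldType) l k (v : 'rV[K]_k) (A : 'M[K]_(l, k)) :
  row_free A -> ~~ (v <= A)%MS -> row_free (col_mx v A).
Proof.
move=> freeA vA; apply: inj_row_free => y; rewrite -[y]hsubmxK mul_row_col.
set c := lsubmx y; set z := rsubmx y; rewrite [c]mx11_scalar mul_scalar_mx => E.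
have c0 : c 0 0 = 0.
  apply: contraNeq vA => c0; have -> : v = - (c 0 0)^-1 *: (z *m A).
    have -> : z *m A = - (c 0 0 *: v) by apply/eqP; rewrite -addr_eq0 addrC E.
    by rewrite scalerN scaleNr opprK scalerA mulVf // scale1r.
  by rewrite scalemxAl submxMl.
have z0 : z = 0.
  by apply: (row_free_inj freeA); rewrite mul0mx -E c0 scale0r add0r.
by rewrite z0 c0 raddf0 row_mx0.
Qed.

(** * Linear subspaces of a nonsingular hypersurface *)

Section LinearSubspaces.
Variables (F : finFieldType) (k d : nat) (p : {mpoly F[k]}).
Local Notation q := #|F|.
Hypotheses (hp : p \is d.-homog) (d2 : (2 <= d)%N) (dq : (d <= q)%N).

(** If p vanished on v + L with v outside L, homogeneity would extend this to the span of v and L,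
    against maximality. *)
Lemma max_subspace : exists l (A : 'M[F]_(l, k)),
  [/\ row_free A, forall y : 'rV_l, eval_row p (y *m A) = 0
    & forall v, ~~ (v <= A)%MS -> exists y : 'rV_l, eval_row p (v + y *m A) != 0].
Proof.
have d0 : (0 < d)%N by apply: ltnW.
pose P l := [exists A : 'M[F]_(l, k), row_free A && [forall y : 'rV_l, eval_row p (y *m A) == 0]].
have P0 : exists l, P l.
  exists 0%N; apply/existsP; exists 0; rewrite /row_free mxrank0 /=.
  apply/forallP=> y; rewrite mulmx0 -(scale0r (0 : 'rV[F]_k)) (eval_homogZ _ _ hp).
  by rewrite expr0n gtn_eqF // mul0r.
have Pk l : P l -> (l <= k)%N.
  by case/existsP=> A /andP[/eqP fA _]; rewrite -[l]fA; apply: rank_leq_col.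
case: (ex_maxnP P0 Pk) => l /existsP[A /andP[freeA /forallP hL]] maxl.
exists l, A; split=> // [y|v vA]; first exact/eqP.
apply/existsP; apply: contraT => /existsPn H.
suff : P (1 + l)%N by move/maxl; rewrite ltnn.
apply/existsP; exists (col_mx v A); apply/andP; split.
  exact: row_free_col_rV.
apply/forallP=> y; rewrite -[y]hsubmxK mul_row_col.
set c := lsubmx y; set z := rsubmx y; rewrite [c]mx11_scalar mul_scalar_mx.
have [->|c0] := eqVneq (c 0 0) 0; first by rewrite scale0r add0r hL.
have -> : c 0 0 *: v + z *m A = c 0 0 *: (v + ((c 0 0)^-1 *: z) *m A).
  by rewrite scalerDr -scalemxAl scalerA divff // scale1r.
by rewrite (eval_homogZ _ _ hp) (eqP (negbNE (H _))) mulr0.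
Qed.

End LinearSubspaces.

Lemma map_homog (R S : comNzRingType) (phi : {rmorphism R -> S}) k d (p : {mpoly R[k]}) :
  p \is d.-homog -> map_mpoly phi p \is d.-homog.
Proof.
move/dhomogP=> hp; rewrite [p]mpolyE rmorph_sum /= big_seq; apply: rpred_sum => m mp.
rewrite map_mpolyZ map_mpolyX; apply: rpredZ; rewrite dhomogX; apply/eqP; exact: hp.
Qed.

Section Closure.
Variables (F : finFieldType) (k d : nat) (p : {mpoly F[k]}).
Local Notation q := #|F|.
Hypotheses (hp : p \is d.-homog) (d2 : (2 <= d)%N) (dq : (d <= q)%N).
Hypothesis nsp : nonsingular p.
Local Notation K := (alg_closure F).
Local Notation phi := (to_closure F).
Local Notation pK := (map_mpoly phi p).

Definition gradient (x : 'rV[K]_k) : 'cV[K]_k := \col_i eval_row pK^`M(i) x.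

Lemma gradient_neq0 x : x != 0 -> eval_row pK x = 0 -> gradient x != 0.
Proof.
move=> x0 px; apply/eqP => g0; apply: (nsp x0); split=> // i.
by have /colP/(_ i) := g0; rewrite !mxE map_mderiv.
Qed.

Lemma gradient_map x i : gradient (map_mx phi x) i 0 = phi (eval_row p^`M(i) x).
Proof. by rewrite mxE -map_mderiv eval_row_map. Qed.

Lemma smooth_points u : u != 0 -> eval_row p u = 0 -> exists i, eval_row p^`M(i) u != 0.
Proof.
move=> u0 pu; have mu0 : map_mx phi u != 0 by rewrite map_mx_eq0.
have pmu : eval_row pK (map_mx phi u) = 0 by rewrite eval_row_map pu rmorph0.
have := gradient_neq0 mu0 pmu.
have [i Hi|H] := pickP (fun i => eval_row p^`M(i) u != 0); first by exists i.
move=> /eqP[]; apply/colP=> i; rewrite gradient_map [RHS]mxE.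
by have /negbFE/eqP -> := H i; rewrite rmorph0.
Qed.

(** On L the derivatives in the directions of L vanish. The derivatives in k - l complementary
    directions are forms of degree d - 1 in l variables; for k - l < l they have a common zero over
    the closure, a singular point. *)
Lemma subspace_dim l (A : 'M[F]_(l, k)) : row_free A ->
  (forall y : 'rV_l, eval_row p (y *m A) = 0) -> (l * 2 <= k)%N.
Proof.
move=> freeA hL; rewrite leqNgt; apply/negP=> lt.
have lk : (l <= k)%N by rewrite -(eqP freeA) rank_leq_col.
have e0 : (0 < d.-1)%N by rewrite -ltnS prednK // ltnW.
pose AK := map_mx phi A.
have rC : \rank (A^C)%MS = (k - l)%N by rewrite mxrank_compl (eqP freeA).
pose C := map_mx phi (row_base (A^C)%MS).
pose G (j : 'I_(\rank (A^C)%MS)) := \sum_i C j i *: asub 0 AK pK^`M(i).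
have ltc : (\rank (A^C)%MS < l)%N by rewrite rC; lia.
have hG j : G j \is d.-1.-homog.
  by apply: rpred_sum => i _; apply: rpredZ; apply: homog_asub; apply: homog_mderiv; apply: map_homog.
have [x [[i xi] Gx]] := forms_common_zero ltc e0 hG.
pose y : 'rV_l := \row_i x i; pose u := y *m AK.
have freeAK : row_free AK by rewrite row_free_map.
have y0 : y != 0 by apply: contraNneq xi => /rowP/(_ i); rewrite !mxE => ->.
have u0 : u != 0.
  by apply: contraNneq y0 => /eqP;
    rewrite -(mul0mx _ AK) (inj_eq (row_free_inj freeAK)).
(* Vanishing at the rational points of L becomes a polynomial identity because d <= q, so it
   persists over the closure. *)
have Ap0 : asub 0 A p = 0.
  apply: (eval_row_vanish dq (homog_asub A hp)) => z.
  by rewrite eval_asub add0r hL.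
have ApK : asub 0 AK pK = 0.
  by have := map_asub phi 0 A p; rewrite Ap0 rmorph0 map_mx0 => <-.
have pu : eval_row pK u = 0.
  by have := eval_asub 0 AK pK y; rewrite add0r ApK eval_row0 => <-.
case/negP: (gradient_neq0 u0 pu).
have AG : AK *m gradient u = 0.
  apply/colP=> j; rewrite mxE [RHS]mxE.
  have := congr1 (fun f => eval_row f^`M(j) y) ApK.
  rewrite /= linear0 eval_row0 mderiv_asub eval_row_sum => E; apply: etrans E.
  by apply: eq_bigr => i' _; rewrite eval_rowZ eval_asub add0r [gradient u i' 0]mxE.
have CG : C *m gradient u = 0.
  apply/colP=> j; rewrite mxE [RHS]mxE.
  have yx : y 0 =1 x by move=> i'; rewrite mxE.
  have := Gx j; rewrite -(meval_eq _ yx) -/(eval_row _ y) eval_row_sum => E;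
    apply: etrans E.
  by apply: eq_bigr => i' _; rewrite eval_rowZ eval_asub add0r [gradient u i' 0]mxE.
have full : row_full (col_mx AK C).
  rewrite -map_col_mx row_full_map -sub1mx -addsmxE.
  apply: (@submx_trans _ _ _ _ _ _ (A + A^C)%MS);
    first by rewrite sub1mx addsmx_compl_full.
  by apply: addsmxS; rewrite ?submx_refl // eq_row_base.
rewrite -(inj_eq (row_full_inj full)) mulmx0 mul_col_mx AG CG.
by apply/eqP; exact: col_mx0.
Qed.

End Closure.

Lemma rank_basis (K : fieldType) m k n (M : 'M[K]_(m, k)) : \rank M = n ->
  exists2 B : 'M[K]_(n, k), row_free B & (B :=: M)%MS.
Proof. by move=> <-; exists (row_base M);
  [apply: row_base_free | apply: eq_row_base]. Qed.

Lemma complement_row (K : fieldType) m k n (T : 'M[K]_(m, k)) (u : 'rV[K]_k) :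
  (u <= T)%MS -> u != 0 -> \rank T = n.+1 ->
  exists B : 'M[K]_(n, k), [/\ row_free B, (B <= T)%MS & ~~ (u <= B)%MS].
Proof.
move=> uT u0 rT; have rD : \rank (T :\: u)%MS = n.
  have := mxrank_cap_compl T u; rewrite rT (capmx_idPr uT) rank_rV u0 add1n.
  by case.
have [B freeB BE] := rank_basis rD; exists B; split; rewrite ?BE ?diffmxSl //.
apply: contra u0 => uD; rewrite -submx0 -(capmx_diff T u) sub_capmx uD.
exact: submx_refl.
Qed.

(** * Tangent sections that are cones *)

Section TangentSection.
Variables (F : finFieldType) (n d : nat) (p : {mpoly F[n.+2]}).
Local Notation q := #|F|.
Hypotheses (hp : p \is d.-homog) (d2 : (2 <= d)%N) (dq : (d <= q)%N).
Hypothesis nsp : nonsingular p.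
Variables (u : 'rV[F]_n.+2) (B : 'M[F]_(n, n.+2)).
Hypotheses (u0 : u != 0) (pu : eval_row p u = 0).
Hypotheses (freeB : row_free B) (BT : (B <= tangent_space p u)%MS) (uB : ~~ (u <= B)%MS).
Local Notation K := (alg_closure F).
Local Notation phi := (to_closure F).
Local Notation pK := (map_mpoly phi p).
Local Notation M := (col_mx u B).

Let d0 : (0 < d)%N. Proof. exact: ltnW. Qed.

Lemma tangent_self : (u <= tangent_space p u)%MS.
Proof.
by rewrite tangentP (dirder_self _ hp) pu mul0rn.
Qed.

Hypothesis cone :
  restrict M p = restrict (col_mx (0 : 'rV[F]_n) 1%:M) (restrict B p).

(* A singular point z of Y would make the whole line joining u to z singular on
   the tangent section; the Gauss map is constant on that line up to a factor of
   degree d - 1 > 0, which has a zero. *)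
Lemma section_nonsingular : nonsingular (restrict B p).
Proof.
rewrite restrictE => z z0 [pz dz].
pose BK := map_mx phi B; pose uK := map_mx phi u; pose MK := map_mx phi M.
pose M0 : 'M[K]_(1 + n, n) := col_mx 0 1%:M.
pose pB := asub 0 BK pK.
have pBE : map_mpoly phi (asub 0 B p) = pB by rewrite map_asub map_mx0.
rewrite pBE in pz.
have {}dz i : eval_row pB^`M(i) z = 0 by rewrite -pBE -map_mderiv dz.
have coneK : asub 0 MK pK = asub 0 M0 pB.
  have := congr1 (map_mpoly phi) cone; rewrite !restrictE !map_asub !map_mx0 => ->.
  by rewrite map_col_mx map_mx0 map_mx1.
have [i0 Hi0] := smooth_points nsp u0 pu.
(* A partial derivative that is nonzero at [u], restricted to the line from z in direction u: its
   coefficient of degree d - 1 is its value at [u], so it is not constant and has a root c. *)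
pose N := lpoly (z *m BK) uK pK^`M(i0).
have hpK : pK \is d.-homog by apply: map_homog.
have N0 : size N != 1.
  apply/negP=> /eqP sz; have := coef_lpoly_homog (z *m BK) uK (homog_mderiv i0 hpK).
  rewrite -/N nth_default ?sz; last by rewrite -ltnS prednK.
  rewrite -map_mderiv eval_row_map => /esym/eqP; rewrite fmorph_eq0.
  by rewrite (negPf Hi0).
have [c /rootP] := closed_rootP _ N0; rewrite horner_lpoly.
pose y : 'rV_(1 + n) := row_mx c%:M z.
have -> : z *m BK + c *: uK = y *m MK.
  by rewrite /MK map_col_mx mul_row_col mul_scalar_mx addrC.
set x := y *m MK => xi0.
have freeM : row_free MK by rewrite row_free_map row_free_col_rV.
have yM0 : y *m M0 = z by rewrite mul_row_col mulmx0 add0r mulmx1.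
have x0 : x != 0.
  apply: contraNneq z0 => /eqP; rewrite -(mul0mx _ MK) (inj_eq (row_free_inj freeM)).
  by move=> /eqP yE; rewrite -yM0 yE mul0mx.
have px : eval_row pK x = 0.
  by have := eval_asub 0 MK pK y; rewrite coneK eval_asub !add0r yM0 pz.
have Mx : MK *m gradient p x = 0.
  apply/colP=> j; rewrite mxE [RHS]mxE.
  have := congr1 (fun f => eval_row f^`M(j) y) coneK.
  rewrite /= !mderiv_asub !eval_row_sum [RHS]big1 => [E|i _]; last first.
    by rewrite eval_rowZ eval_asub add0r yM0 dz mulr0.
  apply: etrans E; apply: eq_bigr => i _.
  by rewrite eval_rowZ eval_asub add0r [gradient p x i 0]mxE.
have Mu : MK *m gradient p uK = 0.
  have : (M <= tangent_space p u)%MS by rewrite col_mx_sub tangent_self.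
  move/sub_kermxP/(congr1 (map_mx phi)); rewrite map_mxM map_mx0 => E; apply: etrans E.
  by congr (_ *m _); apply/colP=> i; rewrite gradient_map !mxE.
have gu0 : gradient p uK i0 0 != 0 by rewrite gradient_map fmorph_eq0.
case/negP: (gradient_neq0 nsp x0 px).
(* The gradients at [x] and [u] both annihilate the hyperplane spanned by [M], hence are
   proportional. The entry [i0] vanishes at [x] but not at [u], so the gradient at [x] is 0. *)
have subK (g : 'cV_n.+2) : MK *m g = 0 -> (g^T <= kermx MK^T)%MS.
  by move=> Mg; apply/sub_kermxP; rewrite -trmx_mul Mg trmx0.
have rK : \rank (kermx MK^T) = 1%N.
  by rewrite mxrank_ker mxrank_tr (eqP freeM) add1n subSnn.
have gT0 : (gradient p uK)^T != 0.
  by apply: contraNneq gu0 => /rowP/(_ i0); rewrite [LHS]mxE => ->; rewrite mxE.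
have : (gradient p x)^T = 0.
  have sub1 : (kermx MK^T <= (gradient p uK)^T)%MS.
    by have [_ <-] := mxrank_leqif_sup (subK _ Mu); rewrite rK rank_rV gT0.
  have /sub_rVP[a aE] := submx_trans (subK _ Mx) sub1.
  have := congr1 (fun r : 'rV_n.+2 => r 0 i0) aE;
    rewrite mxE [gradient p x i0 0]mxE xi0.
  rewrite [RHS]mxE [X in _ * X]mxE => /esym/eqP;
    rewrite mulf_eq0 (negPf gu0) orbF => /eqP a0.
  by rewrite aE a0 scale0r.
by move/(congr1 trmx); rewrite trmxK trmx0 => ->; rewrite eqxx.
Qed.

End TangentSection.

Section Cone.
Variables (F : finFieldType) (n d : nat) (p : {mpoly F[n.+2]}).
Local Notation q := #|F|.
Hypotheses (hp : p \is d.-homog) (dq : (d <= q)%N).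
Variables (u : 'rV[F]_n.+2) (B : 'M[F]_(n, n.+2)).
Hypothesis inv : forall c (z : 'rV_n), eval_row p (z *m B + c *: u) = eval_row p (z *m B).

(** Both sides are forms of degree d <= q, so equality at all rational points suffices. *)
Lemma restrict_cone :
  restrict (col_mx u B) p = restrict (col_mx (0 : 'rV[F]_n) 1%:M) (restrict B p).
Proof.
rewrite !restrictE; apply/eqP; rewrite -subr_eq0; apply/eqP.
apply: (eval_row_vanish dq) => [|y].
  by apply: rpredB; do !apply: homog_asub.
rewrite eval_rowD -scaleN1r eval_rowZ mulN1r !eval_asub !add0r.
rewrite -[y]hsubmxK !mul_row_col mulmx0 add0r mulmx1.
by rewrite [lsubmx y]mx11_scalar mul_scalar_mx [_ *: u + _]addrC inv subrr.
Qed.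

Lemma zeros_cone (T : 'M[F]_n.+2) : row_free (col_mx u B) -> (T :=: col_mx u B)%MS ->
  #|zeros p :&: [set v | (v <= T)%MS]| = (q * #|zeros (restrict B p)|)%N.
Proof.
move=> freeM TE; rewrite restrictE.
pose f (x : F * 'rV[F]_n) := x.2 *m B + x.1 *: u.
have fM x : f x = row_mx x.1%:M x.2 *m col_mx u B.
  by rewrite mul_row_col mul_scalar_mx addrC.
have inj : injective f.
  move=> x1 x2; rewrite !fM => /(row_free_inj freeM)/eq_row_mx[].
  by move/(congr1 (fun r : 'M_1 => r 0 0)); rewrite !mxE /= !mulr1n;
    case: x1 x2 => ? ? [? ?] /= -> ->.
rewrite -(cardsT F) -cardsX -(card_imset _ inj); apply: eq_card => v.
rewrite !inE TE; apply/andP/imsetP => [[pv /submxP[y yE]]|[[c z]]].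
  exists (lsubmx y 0 0, rsubmx y).
    rewrite !inE /= eval_asub add0r -(inv (lsubmx y 0 0)).
    have -> : rsubmx y *m B + lsubmx y 0 0 *: u = v; last by [].
    by rewrite yE -{3}[y]hsubmxK mul_row_col {2}[lsubmx y]mx11_scalar mul_scalar_mx
      addrC.
  by rewrite fM /= -mx11_scalar hsubmxK.
rewrite !inE /= eval_asub add0r => pz ->; split; first by rewrite /f inv.
by rewrite fM submxMl.
Qed.

End Cone.

(** * The bound and the case of equality *)

Theorem theorem2 (F : finFieldType) (n d : nat) (p : {mpoly F[n.+2]})
  (hn5 : (5 <= n)%N) (hn : odd n) (hd : (2 <= d)%N)
  (hX : hypersurface d p) (hns : nonsingular p) (hdq : (d <= #|F|)%N) :
  (Nq [:: p] <= theta F d n)%N /\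
  (Nq [:: p] = theta F d n ->
   exists (v : 'rV[F]_n.+2) (B : 'M[F]_(n, n.+2)),
     [/\ v != 0, eval_row p v = 0, tangent_section_is_cone p v B,
         hypersurface d (restrict B p) /\ nonsingular (restrict B p) &
         Nq [:: restrict B p] = theta F d (n - 2)]).
Proof.
have [_ hp] := hX; have d0 : (0 < d)%N by apply: ltnW.
pose h := (n.+1)./2.
have nh : n = h.*2.-1.
  by have := odd_double_half n.+1; rewrite /= hn add0n /h => ->.
have h3 : (2 < h)%N by move: hn5 nh; rewrite -addnn; lia.
have hk : n.+2 = (2 * h).+1 by rewrite nh mul2n -addnn; lia.
have h1 : (0 < h.-1)%N by lia.
have n2 : (h.-1).*2.-1 = (n - 2)%N by rewrite nh -!addnn; lia.
have h2 : (2 * h.-1 = (2 * h).-2)%N by lia.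
have h22 : (2 * h = (2 * h).-2.+2)%N by lia.
have q1 : (1 < #|F|)%N by apply: finNzRing_gt1.
have q1' : (0 < #|F|.-1)%N by rewrite -ltnS prednK // ltnW.
have [l [A [freeA hL hmax]]] := max_subspace hp hd.
have lh : (l <= h)%N by have := subspace_dim hp hd hdq hns freeA hL; rewrite hk; lia.
have sm := smooth_points hns.
have Z := Nq_zeros d0 hp.
have thE := theta_count F d0 (ltnW (ltnW h3)); rewrite -nh in thE.
have many : (theta F d n <= Nq [:: p])%N ->
    (d.-1 * #|F| ^ (2 * h) + #|F| ^ h <= #|zeros p| + d.-1 * #|F| ^ h)%N.
  by move=> le; rewrite -thE -Z !leq_add2r leq_mul2l le orbT.
split.
  case: (leqP (theta F d n) (Nq [:: p])) => [le|/ltnW //].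
  have := zeros_le hk hp hd hdq h3 hL freeA hmax lh sm (many le).
  by rewrite -Z -thE !leq_add2r leq_pmul2l.
move=> E; have mn := many (eq_leq (esym E)).
have max : (#|zeros p| + d.-1 * #|F| ^ h = d.-1 * #|F| ^ (2 * h) + #|F| ^ h)%N.
  by rewrite -thE -Z E.
have [lE _ _] := many_dims hk hp hd hdq h3 hL freeA hmax lh mn.
have l0 : (0 < l)%N by rewrite lE (leq_trans _ h3).
(* Any nonzero vector of L serves as the vertex. *)
pose w : 'rV[F]_l := delta_mx 0 (Ordinal l0).
have w0 : w != 0.
  by apply/eqP=> /rowP/(_ (Ordinal l0))/eqP; rewrite !mxE !eqxx oner_eq0.
set u := w *m A.
have u0 : u != 0.
  by apply: contraNneq w0 => /eqP; rewrite -(mul0mx _ A) (inj_eq (row_free_inj freeA)).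
have pu : eval_row p u = 0 by apply: hL.
have uT := tangent_self hp pu.
have rT : \rank (tangent_space p u) = n.+1.
  by rewrite (rank_tangent hk sm u0 pu); case: hk.
have [B [freeB BT uB]] := complement_row uT u0 rT.
have freeM := row_free_col_rV freeB uB.
have inv c (z : 'rV_n) : eval_row p (z *m B + c *: u) = eval_row p (z *m B).
  rewrite /u scalemxAl (cone_translate hk hp hd hdq h3 hL freeA hmax lh sm mn) //.
  rewrite -scalemxAl (dirder_homog _ _ _ hp); apply/eqP; rewrite mulf_eq0 orbC.
  by rewrite -tangentP (submx_trans (submxMl _ _) BT).
have cone := restrict_cone hp hdq inv.
have nsY := section_nonsingular hp hd hns u0 pu freeB BT uB cone.
have hY : restrict B p \is d.-homog by rewrite restrictE homog_asub.
exists u, B; split=> //.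
  (* A zero restriction would make every point singular. *)
  split=> //; split=> //; apply/eqP=> Y0; have n0 : (0 < n)%N by apply: leq_trans hn5.
  apply: (nsY (delta_mx 0 (Ordinal n0))).
    by apply/eqP=> /rowP/(_ (Ordinal n0))/eqP; rewrite !mxE !eqxx oner_eq0.
  by rewrite Y0 rmorph0 eval_row0; split=> // i; rewrite linear0 rmorph0 eval_row0.
have TE : (tangent_space p u :=: col_mx u B)%MS.
  apply/eqmxP; rewrite andbC; have sub : (col_mx u B <= tangent_space p u)%MS.
    by rewrite col_mx_sub uT.
  rewrite sub /=; have [_ <-] := mxrank_leqif_sup sub.
  by rewrite (eqP freeM) rT.
(* Each affine zero of Y accounts for q zeros in the tangent space. The resulting count is q^2 times
   the identity of [theta_count] for h - 1, that is, for dimension n - 2. *)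
have := card_tangent_zeros hk hp hd hdq h3 hL freeA hmax lh sm mn max w0.
rewrite (zeros_cone inv freeM TE) -(Nq_zeros d0 hY).
have := theta_count F d0 h1; rewrite n2 h2.
have -> : (#|F| ^ h = #|F| * #|F| ^ h.-1)%N by rewrite -expnS prednK // ltnW // ltnW.
have -> : (#|F| ^ (2 * h) = #|F| * (#|F| * #|F| ^ (2 * h).-2))%N.
  by rewrite -!expnS -h22.
have Q0 : (0 < #|F| ^ h.-1)%N by rewrite expn_gt0 ltnW.
move: (#|F| ^ h.-1)%N (#|F| ^ (2 * h).-2)%N (theta _ _ _) (Nq _) Q0 q1 q1'.
move: (#|F|) (d.-1) => q e Q Q2 th N Q0 q1 q1' E1 E2.
have : (q * q * (q.-1 * N + 1 + e * Q) = q * q * (q.-1 * th + 1 + e * Q))%N.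
  by rewrite E1; move: E2; clear; nia.
move/eqP; rewrite eqn_pmul2l ?muln_gt0 ?(ltnW q1) // !eqn_add2r eqn_pmul2l //.
by move/eqP.
Qed.
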